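(* Let $K>1$. Suppose $f$ is a spectral density bounded away from zero with $\sum_{r\in\mathbb{Z}}|r^Kc_f(r)|<\infty$, and that $f_\theta$ is a spectral density bounded away from zero with $\|f_\theta\|_0<\infty$ (with $f_\theta(\omega)=\sigma_\theta^2|\phi_\theta(\omega)|^{-2}$). Then $$\underline{X}_n'F_n^*\Delta_n(f_\theta^{-1})\left(D_n(f)-D_{\infty,n}(f)\right)\underline{X}_n=\sum_{k=1}^{n}\frac{\overline{J_n(\omega_{k,n})}}{f_\theta(\omega_{k,n})}\left(\widehat{J}_n(\omega_{k,n};f)-\widehat{J}_{\infty,n}(\omega_{k,n};f)\right)$$ and, for some $0<\varepsilon<1$ (entering through the constant $C_{f,0}$), $$\left\|F_n^*\Delta_n(f_\theta^{-1})\left(D_n(f)-D_{\infty,n}(f)\right)\right\|_1\le\frac{C_{f,0}\,\rho_{n,K}(f)}{n^{K-1}}A_K(f,f_\theta).$$ Further, if $\{X_t\}$ is a time series with $\sup_t\|X_t\|_{\mathbb{E},2q}=\|X\|_{\mathbb{E},2q}<\infty$ for some $q>1$, then $$n^{-1}\left\|\underline{X}_n'F_n^*\Delta_n(f_\theta^{-1})\left(D_n(f)-D_{\infty,n}(f)\right)\underline{X}_n\right\|_{\mathbb{E},q}\le\frac{C_{f,0}\,\rho_{n,K}(f)}{n^{K}}A_K(f,f_\theta)\|X\|_{\mathbb{E},2q}^2.$$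
   Context: Time series are real-valued, $\underline{X}_n=(X_1,\ldots,X_n)'$. For a spectral density $f$ (positive, symmetric about $\pi$ on $[0,2\pi]$) with autocovariance $c_f$, $f(\omega)=\sum_rc_f(r)e^{ir\omega}$. Canonical factorisation: $f=\sigma_f^2|\psi_f|^2=\sigma_f^2|\phi_f|^{-2}$ with $\phi_f(\omega)=\phi(\omega;f)=1-\sum_{j\ge1}\phi_j(f)e^{-ij\omega}$ and $\psi_f(\omega)=\psi(\omega;f)=\phi_f(\omega)^{-1}=1+\sum_{j\ge1}\psi_j(f)e^{-ij\omega}$ (the causal, minimum phase AR$(\infty)$ and MA$(\infty)$ coefficients); similarly for $f_\theta$. Norms: for a matrix, $\|A\|_1=\sum_{i,j}|a_{i,j}|$; for a random variable, $\|X\|_{\mathbb{E},q}=(\mathbb{E}|X|^q)^{1/q}$; for $g(\omega)=\sum_rg_re^{ir\omega}$, $\|g\|_K=\sum_{r\in\mathbb{Z}}(2^K+|r|^K)|g_r|$ (so $\|g\|_0=2\sum_r|g_r|$). Quantities: $\rho_{n,K}(f)=\sum_{r=n+1}^\infty|r^K\phi_r(f)|$; $A_K(f,g)=2\sigma_g^{-2}\|\psi_f\|_0\|\phi_g\|_0^2\|\phi_f\|_K$; $C_{f,K}=\frac{3-\varepsilon}{1-\varepsilon}\|\phi_f\|_K^2\|\psi_f\|_K^2$ for some $0<\varepsilon<1$ ($\varepsilon$ does not depend on $n$). $\omega_{k,n}=2\pi k/n$; $(F_n)_{k,t}=n^{-1/2}e^{it\omega_{k,n}}$; $\Delta_n(g)=\mathrm{diag}(g(\omega_{1,n}),\ldots,g(\omega_{n,n}))$;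 $J_n(\omega)=n^{-1/2}\sum_{t=1}^nX_te^{it\omega}$. For $\tau\le0$ and $\tau>n$, $\{\phi_{t,n}(\tau;f)\}_{t=1}^n$ are the coefficients of the best (in mean square) linear predictor of $X_\tau$ given $X_1,\ldots,X_n$ under autocovariance $c_f$; $\widehat{X}_{\tau,n}=\sum_{t=1}^n\phi_{t,n}(\tau;f)X_t$; $\widehat{J}_n(\omega;f)=n^{-1/2}\sum_{\tau\le0}\widehat{X}_{\tau,n}e^{i\tau\omega}+n^{-1/2}\sum_{\tau>n}\widehat{X}_{\tau,n}e^{i\tau\omega}$; and $$D_{n}(f)_{k,t}= n^{-1/2}\sum_{\tau\leq 0}\left(\phi_{t,n}(\tau;f)e^{i\tau\omega_{k,n}}+\phi_{n+1-t,n}(\tau;f)e^{-i(\tau-1)\omega_{k,n}}\right).$$ With $\phi_t^\infty(\omega;f)=\sum_{s=0}^\infty\phi_{t+s}(f)e^{-is\omega}$, $$(D_{\infty,n}(f))_{k,t}=n^{-1/2}\frac{\phi_t^\infty(\omega_{k,n};f)}{\phi(\omega_{k,n};f)}+n^{-1/2}e^{i\omega_{k,n}}\frac{\overline{\phi_{n+1-t}^\infty(\omega_{k,n};f)}}{\overline{\phi(\omega_{k,n};f)}},$$ $$\widehat{J}_{\infty,n}(\omega;f)=\frac{n^{-1/2}}{\phi(\omega;f)}\sum_{t=1}^nX_t\phi_t^\infty(\omega;f)+e^{i(n+1)\omega}\frac{n^{-1/2}}{\overline{\phi(\omega;f)}}\sum_{t=1}^nX_{n+1-t}\overline{\phi_t^\infty(\omega;f)}.$$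 *)

(* Defs.v *)
From HB Require Import structures.
From mathcomp Require Import all_boot all_order all_algebra.
From mathcomp Require Import complex.
From mathcomp Require Import all_classical all_reals all_analysis.

Set Implicit Arguments.
Unset Strict Implicit.
Unset Printing Implicit Defensive.

Import Order.TTheory GRing.Theory Num.Theory.
Import numFieldNormedType.Exports.

Local Open Scope classical_set_scope.
Local Open Scope ring_scope.
Local Open Scope complex_scope.

Section Series.
Context {R : realType}.

Definition cis (x : R) : R[i] := cos x +i* sin x.

(* Real and imaginary parts are summed separately.  The value is meaningful
   when both converge; all the series below converge absolutely under the
   hypotheses under which they are used. *)
Definition cseries (u : nat -> R[i]) : R[i] :=
  limn (series (fun m => complex.Re (u m)))
  +i* limn (series (fun m => complex.Im (u m))).

(* g(omega) = \sum_{r in Z} g_r e^{i r omega} *)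
Definition fourier (g : int -> R) (w : R) : R[i] :=
  cseries (fun m => (g (Posz m))%:C * cis ((Posz m)%:~R * w)) +
  cseries (fun m => (g (Negz m))%:C * cis ((Negz m)%:~R * w)).

(* ||g||_K, as a function of the Fourier coefficients of g.  Since
   0 `^ 0 = 1, this is 2 \sum_r |g_r| for K = 0. *)
Definition normK (K : R) (g : int -> R) : \bar R :=
  (\esum_(r in [set: int]) ((2 `^ K + `|r%:~R| `^ K) * `|g r|)%:E)%E.

End Series.

Section SpectralDensity.
Context {R : realType}.
Implicit Types (f : R -> R) (c : int -> R) (phi psi : nat -> R).

(* c is the autocovariance of f; the Fourier series is required to converge
   absolutely by the summability hypotheses stated alongside. *)
Record spectral_density f c : Prop := SpectralDensity {
  sd_gt0 : forall w, 0 <= w <= 2 * pi -> 0 < f w;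
  sd_sym : forall w, 0 <= w <= 2 * pi -> f (2 * pi - w) = f w;
  sd_even : forall r, c (- r) = c r;
  sd_fourier : forall w, 0 <= w <= 2 * pi -> (f w)%:C = fourier c w }.

Definition bounded_away_from_zero f : Prop :=
  exists2 d : R, 0 < d & forall w, 0 <= w <= 2 * pi -> d <= f w.

(* Coefficients of 1 - \sum_{j >= 1} phi_j e^{-ij omega} and
   1 + \sum_{j >= 1} psi_j e^{-ij omega} in the convention of [fourier]:
   Negz m stands for the integer -(m+1).  The values phi 0 and psi 0 are
   never used. *)
Definition ar_coef phi (r : int) : R :=
  match r with
  | Posz m => (m == 0%N)%:R
  | Negz m => - phi m.+1
  end.

Definition ma_coef psi (r : int) : R :=
  match r with
  | Posz m => (m == 0%N)%:R
  | Negz m => psi m.+1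
  end.

Definition ar_fun phi (w : R) : R[i] := fourier (ar_coef phi) w.
Definition ma_fun psi (w : R) : R[i] := fourier (ma_coef psi) w.

(* f = sigma^2 |psi_f|^2 = sigma^2 |phi_f|^-2 with psi_f = phi_f^-1.  That both
   phi_f and its inverse have absolutely summable one-sided coefficients says
   that the factor is causal and minimum phase, and determines sigma > 0, phi
   and psi (at positive indices) from f. *)
Record canonical_factorisation f (sigma : R) phi psi : Prop :=
  CanonicalFactorisation {
  cf_sigma_gt0 : 0 < sigma;
  cf_phi_summable : (normK 0 (ar_coef phi) < +oo)%E;
  cf_psi_summable : (normK 0 (ma_coef psi) < +oo)%E;
  cf_inverse : forall w, ma_fun psi w = (ar_fun phi w)^-1;
  cf_ma : forall w, 0 <= w <= 2 * pi ->
    f w = sigma ^+ 2 * Normc.normc (ma_fun psi w) ^+ 2;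
  cf_ar : forall w, 0 <= w <= 2 * pi ->
    f w = sigma ^+ 2 * Normc.normc (ar_fun phi w) ^- 2 }.

Definition rho (n : nat) (K : R) phi : \bar R :=
  (\sum_(n.+1 <= r <oo) (`|r%:R `^ K * phi r|)%:E)%E.

(* A_K(f,g), with sigma_g, phi_g the factors of g and phi_f, psi_f those of f *)
Definition A_const (K : R) phi_f psi_f (sigma_g : R) phi_g : \bar R :=
  ((2 * sigma_g ^- 2)%:E * normK 0 (ma_coef psi_f)
   * normK 0 (ar_coef phi_g) ^+ 2 * normK K (ar_coef phi_f))%E.

Definition C_const (eps K : R) phi psi : \bar R :=
  (((3 - eps) / (1 - eps))%:E * normK K (ar_coef phi) ^+ 2
   * normK K (ma_coef psi) ^+ 2)%E.

End SpectralDensity.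

(* Index convention: an ordinal i : 'I_n stands for the index i+1 in 1..n, so
   that n+1-t is [rev_ord]. *)
Section Prediction.
Context {R : realType} (n : nat).
Implicit Types (c : int -> R) (x a : 'cV[R]_n) (phi : nat -> R).

(* E (X_tau - \sum_t a_t X_t)^2, expanded, for a centred stationary process X
   with autocovariance c. *)
Definition mse c (tau : int) a : R :=
  c 0 - 2 * (\sum_(t < n) a t 0 * c (tau - t.+1%:Z))
  + \sum_(s < n) \sum_(t < n) a s 0 * a t 0 * c (s.+1%:Z - t.+1%:Z).

(* (phi_{t,n}(tau;f))_t, the minimiser of the mean square error; it exists and
   is unique when c is the autocovariance of a positive spectral density. *)
Definition best_pred c (tau : int) : 'cV[R]_n :=
  xget 0 [set a | forall b, mse c tau a <= mse c tau b].

Definition pred_coef c (tau : int) (t : 'I_n) : R := best_pred c tau t 0.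

Definition Xhat c x (tau : int) : R := \sum_(t < n) pred_coef c tau t * x t 0.

Definition omega (k : 'I_n) : R := 2 * pi * k.+1%:R / n%:R.

Definition isqrtn : R[i] := ((Num.sqrt n%:R)^-1)%:C.

Definition Fmx : 'M[R[i]]_n :=
  \matrix_(k < n, t < n) (isqrtn * cis (t.+1%:R * omega k)).

Definition Delta (g : R -> R) : 'M[R[i]]_n :=
  diag_mx (\row_(k < n) (g (omega k))%:C).

Definition J x (w : R) : R[i] :=
  isqrtn * \sum_(t < n) (x t 0)%:C * cis (t.+1%:R * w).

(* tau <= 0 is written tau = -m, and tau > n is written tau = n+1+m. *)
Definition Jhat c x (w : R) : R[i] :=
  isqrtn * cseries (fun m =>
    (Xhat c x (- m%:Z))%:C * cis ((- m%:Z)%:~R * w)) +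
  isqrtn * cseries (fun m =>
    (Xhat c x (n.+1 + m)%N%:Z)%:C * cis ((n.+1 + m)%:R * w)).

Definition Dmx c : 'M[R[i]]_n := \matrix_(k < n, t < n)
  (isqrtn * cseries (fun m =>
    (pred_coef c (- m%:Z) t)%:C * cis ((- m%:Z)%:~R * omega k) +
    (pred_coef c (- m%:Z) (rev_ord t))%:C
      * cis (- (- m%:Z - 1)%:~R * omega k))).

Definition phi_inf phi (t : 'I_n) (w : R) : R[i] :=
  cseries (fun s => (phi (t.+1 + s)%N)%:C * cis (- (s%:R * w))).

Definition Dinf phi : 'M[R[i]]_n := \matrix_(k < n, t < n)
  (isqrtn * (phi_inf phi t (omega k) / ar_fun phi (omega k)) +
   isqrtn * cis (omega k) *
     (conjc (phi_inf phi (rev_ord t) (omega k))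
      / conjc (ar_fun phi (omega k)))).

Definition Jhat_inf phi x (w : R) : R[i] :=
  isqrtn / ar_fun phi w * (\sum_(t < n) (x t 0)%:C * phi_inf phi t w) +
  cis (n.+1%:R * w) * (isqrtn / conjc (ar_fun phi w)) *
    (\sum_(t < n) (x (rev_ord t) 0)%:C * conjc (phi_inf phi t w)).

Definition adjoint (A : 'M[R[i]]_n) : 'M[R[i]]_n := (map_mx conjc A)^T.

Definition norm1 (A : 'M[R[i]]_n) : R :=
  \sum_(i < n) \sum_(j < n) Normc.normc (A i j).

Definition qform (A : 'M[R[i]]_n) x : R[i] :=
  ((map_mx (real_complex R) x)^T *m A *m map_mx (real_complex R) x) 0 0.

(* F_n^* Delta_n(g^-1) (D_n(f) - D_{infty,n}(f)) *)
Definition FDD (g : R -> R) c phi : 'M[R[i]]_n :=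
  adjoint Fmx *m Delta (fun w => (g w)^-1) *m (Dmx c - Dinf phi).

End Prediction.

Definition sample {R : realType} {d : measure_display} {T : measurableType d}
    {P : probability T R} (X : int -> {RV P >-> R}) (n : nat) (w : T) :
    'cV[R]_n :=
  \col_(t < n) X t.+1%:Z w.

(* sup_t ||X_t||_{E,p} *)
Definition sup_norm {R : realType} {d : measure_display} {T : measurableType d}
    {P : probability T R} (p : R) (X : int -> {RV P >-> R}) : \bar R :=
  ereal_sup (range (fun t : int => Lnorm P p%:E (fun w => (X t w)%:E))).

(* Main.v *)
(** The entries of F* Delta(1/g) (D_n - D_infty) are aliased Fourier coefficients of
    the product of 1/g with the symbol of D_n - D_infty, so the l1 norm is at most
    |1/g| times the sum over tau and t of |phi_{t,n}(tau) - phi_t(tau)|.  For fixed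
    tau this difference solves a Toeplitz system whose right-hand side is c convolved
    with the coefficients phi_t(tau), t > n; Baxter's inequality bounds it because
    Toeplitz matrices are bounded below in l1 uniformly in n.  Indeed, for x supported
    in 1..n and y = c * x, the factorisation c = s2 psi * psi~ shows that the part of
    y beyond n is controlled by the middle part plus a small multiple (a tail of phi)
    of the part before 1, and conversely; for the finitely many small n positive
    definiteness suffices.  The resulting constant, which depends on f alone, is
    absorbed by (3 - eps)/(1 - eps), unbounded as eps tends to 1.  Finally
    sum_tau sum_{t>n} |phi_t(tau)| <= |psi| sum_{u>n} (u - n) |phi_u|
    <= |psi| n^{1-K} rho_{n,K}.  Convolution identities are read off from Fourier
    series, whose injectivity follows from aliasing at the N-th roots of unity. *)

Require Import Defs.
From HB Require Import structures.
From mathcomp Require Import all_boot all_order all_algebra.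
From mathcomp Require Import complex.
From mathcomp Require Import all_classical all_reals all_analysis.
From mathcomp Require Import measurable_realfun.
From mathcomp Require Import lra ring zify.

Set Implicit Arguments.
Unset Strict Implicit.
Unset Printing Implicit Defensive.

Import Order.TTheory GRing.Theory Num.Theory.
Import numFieldNormedType.Exports.

Local Open Scope classical_set_scope.
Local Open Scope ring_scope.
Local Open Scope complex_scope.

(** * Absolutely summable families *)

Section AbsoluteSums.
Context {R : realType}.
Implicit Types (I J : choiceType).

(** The order of the quantifiers shapes the proof: [eps] is fixed from f alone, before f_theta and
    n, and the bound is claimed for every n >= 1. An asymptotic Baxter inequality would leave small
    n open, so the lower bound for Toeplitz matrices is first made uniform in n. It is proved in l1
    because the aliased entries, the symbol 1/f_theta and the prediction coefficients are all
    measured there. The two matrices become comparable because the coefficients of the predictor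
    from the infinite half line are the Fourier coefficients of phi_t^infty / phi, so D_n and
    D_infty have the same shape. Their tau > n halves are mirror images of the tau <= 0 halves: c is
    even, and e^{i n omega} = 1 at the sampling frequencies. Sums are taken over unordered index
    types, with values in the extended reals for nonnegative terms. Reindexing and Tonelli then
    apply directly, and the ordered limits of the definitions enter only through [cseriesE]. *)

Definition nsum I (u : I -> R) : \bar R := (\esum_(i in setT) (u i)%:E)%E.

Definition abssum I (u : I -> R) : \bar R := nsum (fun i => `|u i|).

Definition l1 I (u : I -> R) : Prop := (abssum u < +oo)%E.

(* Writing u as (|u| + u) - |u| exhibits it as a difference of two nonnegative
   families.  Meaningful when u is absolutely summable. *)
Definition rsum I (u : I -> R) : R :=
  fine (nsum (fun i => `|u i| + u i)) - fine (abssum u).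

Lemma nsum_ge0 I (u : I -> R) : (forall i, 0 <= u i) -> (0 <= nsum u)%E.
Proof. by move=> u0; apply: esum_ge0 => i _; rewrite lee_fin. Qed.

Lemma abssum_ge0 I (u : I -> R) : (0 <= abssum u)%E.
Proof. exact: nsum_ge0. Qed.

Lemma eq_nsum I (u v : I -> R) : u =1 v -> nsum u = nsum v.
Proof. by move=> uv; congr nsum; apply/funext. Qed.

Lemma eq_rsum I (u v : I -> R) : u =1 v -> rsum u = rsum v.
Proof. by move=> uv; congr rsum; apply/funext. Qed.

Lemma le_nsum I (u v : I -> R) :
  (forall i, u i <= v i) -> (nsum u <= nsum v)%E.
Proof. by move=> uv; apply: le_esum => i _; rewrite lee_fin. Qed.

Lemma nsumD I (u v : I -> R) : (forall i, 0 <= u i) -> (forall i, 0 <= v i) ->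
  nsum (fun i => u i + v i) = (nsum u + nsum v)%E.
Proof.
move=> u0 v0; rewrite /nsum -esumD; first by apply: eq_esum => i _; rewrite EFinD.
- by move=> i _; rewrite lee_fin.
- by move=> i _; rewrite lee_fin.
Qed.

Lemma abssum_nneg I (u : I -> R) : (forall i, 0 <= u i) -> abssum u = nsum u.
Proof. by move=> u0; apply: eq_nsum => i; rewrite ger0_norm. Qed.

Lemma l1_le I (u v : I -> R) : (forall i, `|u i| <= `|v i|) -> l1 v -> l1 u.
Proof. by move=> uv; apply: le_lt_trans; apply: le_nsum. Qed.

Lemma eq_l1 I (u v : I -> R) : u =1 v -> l1 v -> l1 u.
Proof. by move=> uv; apply: l1_le => i; rewrite uv. Qed.

Lemma l1_norm I (u : I -> R) : l1 u -> l1 (fun i => `|u i|).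
Proof. by apply: l1_le => i; rewrite normr_id. Qed.

Lemma l1_fin_num I (u : I -> R) : l1 u -> abssum u \is a fin_num.
Proof. by move=> lu; rewrite ge0_fin_numE// abssum_ge0. Qed.

Lemma l1D I (u v : I -> R) : l1 u -> l1 v -> l1 (fun i => u i + v i).
Proof.
move=> lu lv; apply: le_lt_trans (lte_add_pinfty lu lv).
by rewrite /abssum -nsumD//; apply: le_nsum => i; exact: ler_normD.
Qed.

Lemma l1N I (u : I -> R) : l1 u -> l1 (fun i => - u i).
Proof. by apply: l1_le => i; rewrite normrN. Qed.

Lemma l1B I (u v : I -> R) : l1 u -> l1 v -> l1 (fun i => u i - v i).
Proof. by move=> lu /l1N; exact: l1D. Qed.

Lemma l1_0 I : l1 (fun _ : I => 0 : R).
Proof. by rewrite /l1 /abssum /nsum esum1 ?ltry// => i _; rewrite normr0. Qed.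

Lemma nsum_fin I (u : I -> R) : (forall i, 0 <= u i) -> l1 u ->
  nsum u \is a fin_num.
Proof. by move=> u0 /l1_fin_num; rewrite abssum_nneg. Qed.

(** Independence of the decomposition: with u = p - q, the identity (|u| + u) + q = |u| + p holds
    termwise, and all four sums are finite, so they may be rearranged. *)
Lemma rsum_split I (p q : I -> R) :
  (forall i, 0 <= p i) -> (forall i, 0 <= q i) -> l1 p -> l1 q ->
  rsum (fun i => p i - q i) = fine (nsum p) - fine (nsum q).
Proof.
move=> p0 q0 lp lq.
have l : l1 (fun i => p i - q i) by exact: l1B.
set u := fun i => p i - q i.
have u0 i : 0 <= `|u i| + u i by have := ler_norm (- u i); rewrite normrN; lra.
have lu : l1 (fun i => `|u i| + u i) by apply: l1D => //; exact: l1_norm.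
have /(congr1 fine) : (nsum (fun i => `|u i| + u i)%R + nsum q = abssum u + nsum p)%E.
  by rewrite /abssum -!nsumD//; apply: eq_nsum => i; rewrite /u; lra.
have fu := l1_fin_num l; have fuu := nsum_fin u0 lu.
have fp := nsum_fin p0 lp; have fq := nsum_fin q0 lq.
by rewrite !fineD// /rsum; lra.
Qed.

Lemma rsum_nneg I (u : I -> R) : (forall i, 0 <= u i) -> l1 u ->
  rsum u = fine (nsum u).
Proof.
move=> u0 lu; transitivity (rsum (fun i => u i - 0)).
  by apply: eq_rsum => i; rewrite subr0.
rewrite rsum_split//; last exact: l1_0.
by rewrite [X in _ - fine X]esum1 ?subr0.
Qed.

Lemma nsum_rsum I (u : I -> R) : (forall i, 0 <= u i) -> l1 u ->
  nsum u = (rsum u)%:E.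
Proof. by move=> u0 lu; rewrite rsum_nneg// fineK// nsum_fin. Qed.

Lemma abssum_rsum I (u : I -> R) : l1 u ->
  abssum u = (rsum (fun i => `|u i|))%:E.
Proof. by move=> lu; rewrite -nsum_rsum//; exact: l1_norm. Qed.

(** Twice the positive part of [u]; with |u| it is the canonical nonnegative decomposition behind
    [rsum]. *)
Definition abs_add I (u : I -> R) i := `|u i| + u i.

Lemma abs_add_ge0 I (u : I -> R) i : 0 <= abs_add u i.
Proof. by rewrite /abs_add; have := ler_norm (- u i); rewrite normrN; lra. Qed.

Lemma l1_abs_add I (u : I -> R) : l1 u -> l1 (abs_add u).
Proof. by move=> lu; apply: l1D => //; exact: l1_norm. Qed.

Lemma rsumE I (u p q : I -> R) :
  (forall i, u i = p i - q i) ->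
  (forall i, 0 <= p i) -> (forall i, 0 <= q i) -> l1 p -> l1 q ->
  rsum u = fine (nsum p) - fine (nsum q).
Proof. by move=> /eq_rsum -> *; exact: rsum_split. Qed.

Lemma rsumD I (u v : I -> R) : l1 u -> l1 v ->
  rsum (fun i => u i + v i) = rsum u + rsum v.
Proof.
move=> lu lv.
rewrite (@rsumE _ _ (fun i => abs_add u i + abs_add v i)
   (fun i => `|u i| + `|v i|)).
- rewrite (nsumD (abs_add_ge0 u) (abs_add_ge0 v)).
  rewrite (@nsumD _ (fun i => `|u i|) (fun i => `|v i|))//.
  have fu := nsum_fin (abs_add_ge0 u) (l1_abs_add lu).
  have fv := nsum_fin (abs_add_ge0 v) (l1_abs_add lv).
  have fu' := l1_fin_num lu; have fv' := l1_fin_num lv.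
  by rewrite !fineD// opprD addrACA.
- by move=> i; rewrite /abs_add; lra.
- by move=> i; rewrite addr_ge0// abs_add_ge0.
- by move=> i; rewrite addr_ge0.
- by apply: l1D; exact: l1_abs_add.
- by apply: l1D; exact: l1_norm.
Qed.

Lemma rsumN I (u : I -> R) : l1 u -> rsum (fun i => - u i) = - rsum u.
Proof.
move=> lu; rewrite (@rsumE _ _ (fun i => `|u i|) (abs_add u)) ?opprB//.
- by move=> i; rewrite /abs_add; lra.
- exact: abs_add_ge0.
- exact: l1_norm.
- exact: l1_abs_add.
Qed.

Lemma rsumB I (u v : I -> R) : l1 u -> l1 v ->
  rsum (fun i => u i - v i) = rsum u - rsum v.
Proof. by move=> lu lv; rewrite rsumD ?rsumN//; exact: l1N. Qed.

Lemma rsum_ge0 I (u : I -> R) : (forall i, 0 <= u i) -> l1 u -> 0 <= rsum u.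
Proof. by move=> u0 lu; rewrite rsum_nneg// fine_ge0// nsum_ge0. Qed.

Lemma ler_rsum I (u v : I -> R) : l1 u -> l1 v -> (forall i, u i <= v i) ->
  rsum u <= rsum v.
Proof.
move=> lu lv uv; rewrite -subr_ge0 -rsumB//; apply: rsum_ge0 => [i|].
  by rewrite subr_ge0.
exact: l1B.
Qed.

Lemma ler_norm_rsum I (u : I -> R) : l1 u ->
  `|rsum u| <= rsum (fun i => `|u i|).
Proof.
move=> lu; have ln := l1_norm lu.
rewrite ler_norml -(rsumN ln); apply/andP; split.
  apply: ler_rsum (l1N ln) lu _ => i.
  by have := ler_norm (- u i); rewrite normrN; lra.
by apply: ler_rsum => // i; exact: ler_norm.
Qed.

Lemma rsum_0 I : rsum (fun _ : I => 0 : R) = 0.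
Proof. by rewrite rsum_nneg ?[nsum _]esum1//; exact: l1_0. Qed.

Lemma nsum_pZ I (k : R) (u : I -> R) : 0 <= k -> (forall i, 0 <= u i) ->
  nsum (fun i => k * u i) = (k%:E * nsum u)%E.
Proof.
(* One inequality for all h >= 0 is enough: the converse for k != 0 is this inequality for k^-1
   applied to k * u. *)
have le_pZ (h : R) (v : I -> R) : 0 <= h -> (forall i, 0 <= v i) ->
    (nsum (fun i => (h * v i)%R) <= h%:E * nsum v)%E.
  move=> h0 v0; apply: ge_ereal_sup => _ [X [finX _] <-].
  under eq_fsbigr do rewrite EFinM.
  rewrite -ge0_mule_fsumr; last by move=> i; rewrite lee_fin.
  rewrite lee_wpmul2l// esum_ge//; exists X => //; split => //.
move=> k0 u0; apply/eqP; rewrite eq_le le_pZ//=.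
have [->|kN0] := eqVneq k 0.
  by rewrite mul0e; apply: nsum_ge0 => i; rewrite mul0r.
rewrite -[leRHS]mul1e -(divff kN0) EFinM -muleA lee_wpmul2l//.
apply: le_trans (le_pZ _ _ _ _); rewrite ?invr_ge0//; last by move=> i; rewrite mulr_ge0.
by apply: le_nsum => i; rewrite mulrA mulVf// mul1r.
Qed.

Lemma l1Z I (k : R) (u : I -> R) : l1 u -> l1 (fun i => k * u i).
Proof.
move=> lu; rewrite /l1 /abssum (@eq_nsum _ _ (fun i => `|k| * `|u i|)).
  rewrite nsum_pZ// -/(abssum u) -(fineK (l1_fin_num lu)) -EFinM.
  exact: ltry.
by move=> i; rewrite normrM.
Qed.

Lemma rsumZ I (k : R) (u : I -> R) : l1 u ->
  rsum (fun i => k * u i) = k * rsum u.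
Proof.
move=> lu.
have H (h : R) : 0 <= h -> rsum (fun i => h * u i) = h * rsum u.
  move=> h0; rewrite (@rsumE _ _ (fun i => h * abs_add u i) (fun i => h * `|u i|)).
  - rewrite !nsum_pZ//; last exact: abs_add_ge0.
    have fp := nsum_fin (abs_add_ge0 u) (l1_abs_add lu).
    by rewrite !fineM// ?l1_fin_num// -mulrBr.
  - by move=> i; rewrite /abs_add; lra.
  - by move=> i; rewrite mulr_ge0// abs_add_ge0.
  - by move=> i; rewrite mulr_ge0.
  - by apply: l1Z; exact: l1_abs_add.
  - by apply: l1Z; exact: l1_norm.
have [k0|/ltW k0] := leP 0 k; first exact: H.
rewrite -[k]opprK (@eq_rsum _ _ (fun i => - (- k * u i))).
  by rewrite rsumN ?H ?mulNr ?oppr_ge0//; exact: l1Z.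
by move=> i; rewrite mulNr.
Qed.

Lemma l1Zr I (k : R) (u : I -> R) : l1 u -> l1 (fun i => u i * k).
Proof. by move=> /(l1Z k); apply: eq_l1 => i; rewrite mulrC. Qed.

Lemma rsumZr I (k : R) (u : I -> R) : l1 u ->
  rsum (fun i => u i * k) = rsum u * k.
Proof. by move=> lu; rewrite mulrC -rsumZ//; apply: eq_rsum => i; rewrite mulrC. Qed.

Lemma l1_sum I (J : Type) (r : seq J) (P : pred J) (u : J -> I -> R) :
  (forall j, P j -> l1 (u j)) -> l1 (fun i => \sum_(j <- r | P j) u j i).
Proof.
move=> lu; elim: r => [|j r ih].
  by apply: eq_l1 (l1_0 _) => i; rewrite big_nil.
have [Pj|nPj] := boolP (P j).
  by apply: eq_l1 (l1D (lu _ Pj) ih) => i; rewrite big_cons Pj.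
by apply: eq_l1 ih => i; rewrite big_cons (negbTE nPj).
Qed.

Lemma rsum_sum I (J : Type) (r : seq J) (P : pred J) (u : J -> I -> R) :
  (forall j, P j -> l1 (u j)) ->
  rsum (fun i => \sum_(j <- r | P j) u j i) = \sum_(j <- r | P j) rsum (u j).
Proof.
move=> lu; elim: r => [|j r ih].
  by rewrite big_nil -[RHS](rsum_0 I); apply: eq_rsum => i; rewrite big_nil.
rewrite big_cons; case: ifP => Pj.
  rewrite -ih -rsumD; [|exact: lu|exact: l1_sum].
  by apply: eq_rsum => i; rewrite big_cons Pj.
by rewrite -ih; apply: eq_rsum => i; rewrite big_cons Pj.
Qed.

Lemma nsum_delta I (a : I) (u : I -> R) : 0 <= u a ->
  (forall i, i != a -> u i = 0) -> nsum u = (u a)%:E.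
Proof.
move=> ua u0; rewrite /nsum (esumID [set a]); last first.
  move=> i _; rewrite lee_fin; have [->//|/u0 ->//] := eqVneq i a.
rewrite setTI esum_set1 ?lee_fin// esum1 ?adde0// => i [_ /= ia].
by rewrite u0//; apply/eqP.
Qed.

Lemma l1_delta I (a : I) (u : I -> R) :
  (forall i, i != a -> u i = 0) -> l1 u.
Proof.
move=> u0; rewrite /l1 /abssum (nsum_delta (a := a)) ?ltry// => i ia.
by rewrite u0 ?normr0.
Qed.

Lemma rsum_delta I (a : I) (u : I -> R) :
  (forall i, i != a -> u i = 0) -> rsum u = u a.
Proof.
move=> u0; rewrite /rsum /abssum !(nsum_delta (a := a))//=.
- by lra.
- by move=> i /u0 ->; rewrite normr0.
- exact: abs_add_ge0.
- by move=> i /u0 ->; rewrite normr0 addr0.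
Qed.

Lemma ler_term_rsum I (u : I -> R) (a : I) : l1 u -> (forall i, 0 <= u i) ->
  u a <= rsum u.
Proof.
move=> lu u0; set v := fun i => if i == a then u a else 0.
have va i : i != a -> v i = 0 by rewrite /v => /negbTE ->.
suff -> : u a = rsum v.
  apply: ler_rsum => //; first exact: l1_delta va.
  by move=> i; rewrite /v; case: eqP => // ->.
by rewrite (rsum_delta va) /v eqxx.
Qed.

Lemma rsum_eq0 I (u : I -> R) : l1 u -> (forall i, 0 <= u i) ->
  rsum u = 0 -> forall i, u i = 0.
Proof.
move=> lu u0 s0 i; apply/eqP; rewrite eq_le u0 andbT -s0.
exact: ler_term_rsum.
Qed.

Lemma nsum_prod I J (u : I * J -> R) : (forall k, 0 <= u k) ->
  nsum u = (\esum_(i in setT) nsum (fun j => u (i, j)))%E.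
Proof.
move=> u0; rewrite /nsum esum_esum => [|i j _ _]; last by rewrite lee_fin.
rewrite (_ : [set: I] `*`` (fun=> [set: J]) = setT).
  by apply: eq_esum => -[].
by apply/seteqP; split.
Qed.

Lemma l1_prod I J (u : I * J -> R) : (forall i, l1 (fun j => u (i, j))) ->
  l1 (fun i => rsum (fun j => `|u (i, j)|)) -> l1 u.
Proof.
move=> lu lU; rewrite /l1 /abssum nsum_prod//.
rewrite (@eq_esum _ _ _ _ (fun i => (rsum (fun j => `|u (i, j)|))%:E)).
  rewrite -/(nsum _) -abssum_nneg// => i; apply: rsum_ge0 => //.
  exact: l1_norm.
by move=> i _; rewrite -/(abssum _) abssum_rsum.
Qed.

Lemma nsum_inj I J (e : J -> I) (u : I -> R) : injective e ->
  (forall i, 0 <= u i) -> (nsum (u \o e) <= nsum u)%E.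
Proof.
move=> inje u0; rewrite /nsum [leRHS](esumID (range e)); last first.
  by move=> i _; rewrite lee_fin.
rewrite setTI (esum_image setT e); last by move=> x y _ _; exact: inje.
by rewrite leeDl// esum_ge0// => i _; rewrite lee_fin.
Qed.

Lemma l1_inj I J (e : J -> I) (u : I -> R) : injective e -> l1 u ->
  l1 (u \o e).
Proof. by move=> inje; apply: le_lt_trans; exact: (nsum_inj (u := fun i => `|u i|) inje). Qed.

Lemma nsum_bij I J (e : J -> I) (u : I -> R) : bijective e ->
  nsum (u \o e) = nsum u.
Proof.
move=> [g eg ge]; rewrite [RHS](@reindex_esum _ _ _ setT setT e)//; split => //.
- by move=> x y _ _; exact: (can_inj eg).
- by move=> x _; exists (g x).
Qed.

Lemma rsum_bij I J (e : J -> I) (u : I -> R) : bijective e ->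
  rsum (u \o e) = rsum u.
Proof.
move=> be; rewrite /rsum /abssum -(nsum_bij _ be).
by rewrite -[in RHS](nsum_bij (fun i => `|u i|) be).
Qed.

Lemma l1_swap I J (u : I * J -> R) : l1 u -> l1 (fun k => u (k.2, k.1)).
Proof. by apply: (l1_inj (e := fun k : J * I => (k.2, k.1))) => -[? ?] [? ?] [-> ->]. Qed.

Lemma rsum_swap I J (u : I * J -> R) : rsum (fun k => u (k.2, k.1)) = rsum u.
Proof.
rewrite -[RHS](rsum_bij (e := fun k : J * I => (k.2, k.1)))//.
by exists (fun k => (k.2, k.1)) => -[].
Qed.

Lemma l1_slice I J (u : I * J -> R) i : l1 u -> l1 (fun j => u (i, j)).
Proof. by apply: (l1_inj (e := fun j => (i, j))) => ? ? []. Qed.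

Lemma nsum_prod_rsum I J (u : I * J -> R) : (forall k, 0 <= u k) -> l1 u ->
  nsum u = nsum (fun i => rsum (fun j => u (i, j))).
Proof.
move=> u0 lu; rewrite nsum_prod//; apply: eq_esum => i _.
by rewrite nsum_rsum//; exact: l1_slice.
Qed.

Lemma l1_rsum_slice I J (u : I * J -> R) : l1 u ->
  l1 (fun i => rsum (fun j => u (i, j))).
Proof.
move=> lu; apply: (@l1_le _ _ (fun i => rsum (fun j => `|u (i, j)|))).
  move=> i; apply: le_trans (ler_norm _); apply: ler_norm_rsum.
  exact: l1_slice.
rewrite /l1 abssum_nneg.
  by rewrite -(@nsum_prod_rsum _ _ (fun k => `|u k|))//; exact: l1_norm.
by move=> i; apply: rsum_ge0 => //; apply: l1_norm; exact: l1_slice.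
Qed.

(** Fubini, obtained from Tonelli ([nsum_prod]) on both members of the decomposition [abs_add u],
    |u|. *)
Lemma rsum_prod I J (u : I * J -> R) : l1 u ->
  rsum u = rsum (fun i => rsum (fun j => u (i, j))).
Proof.
move=> lu; have lp := l1_abs_add lu; have ln := l1_norm lu.
rewrite [RHS](rsumE (p := fun i => rsum (fun j => abs_add u (i, j)))
                    (q := fun i => rsum (fun j => `|u (i, j)|))).
- by rewrite -(nsum_prod_rsum (abs_add_ge0 u) lp) -(@nsum_prod_rsum _ _ (fun k => `|u k|)).
- move=> i; rewrite -rsumB; last exact: (l1_slice i ln).
    by apply: eq_rsum => j; rewrite /abs_add; lra.
  exact: (l1_slice i lp).
- by move=> i; apply: rsum_ge0 => [j|]; [exact: abs_add_ge0|exact: l1_slice].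
- by move=> i; apply: rsum_ge0 => //; exact: (l1_slice i ln).
- exact: l1_rsum_slice.
- exact: (l1_rsum_slice ln).
Qed.

Lemma rsum_exchange I J (u : I -> J -> R) : l1 (fun k => u k.1 k.2) ->
  rsum (fun i => rsum (u i)) = rsum (fun j => rsum (u ^~ j)).
Proof.
move=> lu; rewrite -(rsum_prod lu) -(rsum_prod (l1_swap lu)).
exact/esym/(rsum_swap (fun k => u k.1 k.2)).
Qed.

Lemma nsum_split_range I J1 J2 (e1 : J1 -> I) (e2 : J2 -> I) (u : I -> R) :
  injective e1 -> injective e2 -> range e2 = ~` range e1 ->
  (forall i, 0 <= u i) ->
  nsum u = (nsum (u \o e1) + nsum (u \o e2))%E.
Proof.
move=> i1 i2 e12 u0; rewrite {1}/nsum (esumID (range e1)); last first.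
  by move=> i _; rewrite lee_fin.
rewrite !setTI -e12 (esum_image setT e1); last by move=> x y _ _; exact: i1.
by rewrite (esum_image setT e2)// => x y _ _; exact: i2.
Qed.

Lemma range_Negz : range Negz = ~` range Posz.
Proof.
apply/seteqP; split => [_ [m _ <-] [k _]|] // [k|k] //= H; last by exists k.
by exfalso; apply: H; exists k.
Qed.

Lemma nsum_int (u : int -> R) : (forall i, 0 <= u i) ->
  nsum u = (nsum (u \o Posz) + nsum (u \o Negz))%E.
Proof.
by apply: nsum_split_range => [? ? []|? ? []|] //; exact: range_Negz.
Qed.

Lemma abssum_int (u : int -> R) :
  abssum u = (abssum (u \o Posz) + abssum (u \o Negz))%E.
Proof. exact: nsum_int. Qed.

Lemma rsum_int (u : int -> R) : l1 u ->
  rsum u = rsum (u \o Posz) + rsum (u \o Negz).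
Proof.
move=> lu; have lP : l1 (u \o Posz) by apply: l1_inj lu => ? ? [].
have lN : l1 (u \o Negz) by apply: l1_inj lu => ? ? [].
rewrite [LHS]/rsum abssum_int nsum_int; last exact: abs_add_ge0.
have fP := nsum_fin (abs_add_ge0 (u \o Posz)) (l1_abs_add lP).
have fN := nsum_fin (abs_add_ge0 (u \o Negz)) (l1_abs_add lN).
have gP := l1_fin_num lP; have gN := l1_fin_num lN.
by rewrite (fineD fP fN) (fineD gP gN) opprD addrACA.
Qed.

Lemma nsum_nat_cvg (u : nat -> R) : (forall i, 0 <= u i) -> l1 u ->
  series u @ \oo --> fine (nsum u).
Proof.
move=> u0 lu.
have e : (\sum_(i <oo) (u i)%:E)%E = nsum u.
  by rewrite /nsum nneseries_esumT// => n; rewrite lee_fin.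
have c : (fun n => (\sum_(0 <= i < n) (u i)%:E)%E) @ \oo --> nsum u.
  rewrite -e; apply: is_cvg_nneseries => n _ _.
  by rewrite lee_fin.
rewrite -(fineK (nsum_fin u0 lu)) in c.
suff -> : series u = fine \o (fun n => (\sum_(0 <= i < n) (u i)%:E)%E).
  exact: fine_cvg.
by apply/funext => n /=; rewrite sumEFin.
Qed.

Lemma cvg_rsum_nat (u : nat -> R) : l1 u -> series u @ \oo --> rsum u.
Proof.
move=> lu; have -> : series u = series (abs_add u) - series (fun i => `|u i|).
  apply/funext => n; rewrite /series /= fctE -sumrB; apply: eq_bigr => i _.
  by rewrite /abs_add; lra.
apply: cvgB; apply: nsum_nat_cvg => //.
- exact: abs_add_ge0.
- exact: l1_abs_add.
- exact: l1_norm.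
Qed.

Lemma limn_series_rsum (u : nat -> R) : l1 u -> limn (series u) = rsum u.
Proof. by move=> /cvg_rsum_nat; apply: cvg_lim. Qed.

Lemma l1_tail I (u : I -> R) (e : R) : l1 u -> 0 < e ->
  exists2 A : set I, finite_set A &
    rsum (fun i => if i \in A then 0 else `|u i|) < e.
Proof.
move=> lu e0; have fu := l1_fin_num lu.
have : (abssum u - e%:E < abssum u)%E.
  by rewrite lteBlDr// lteDl ?lte_fin// fin_numE.
move=> /ereal_sup_gt[_ [A [finA _] <-]] h; exists A => //.
have lA : l1 (fun i => if i \in A then 0 else `|u i|).
  apply: l1_le lu => i; case: ifP => _; rewrite ?normr0 ?normr_id//.
rewrite -lte_fin -nsum_rsum//; last by move=> i; case: ifP.
have : abssum u = (\sum_(i \in A) `|u i|%:E +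
    nsum (fun i => if i \in A then 0 else `|u i|)%R)%E.
  rewrite {1}/abssum {1}/nsum (esumID A) => [|i _]; last by rewrite lee_fin.
  rewrite !setTI esum_fset//; congr (_ + _)%E.
  rewrite esum_mkcond; apply: eq_esum => i _.
  by rewrite in_setC; case: (i \in A).
move: h; set S := (\sum_(i \in A) _)%E; set T := nsum _ => h E.
have fT : T \is a fin_num.
  by apply: nsum_fin lA => i; case: ifP.
have fS : S \is a fin_num by move: fu; rewrite E fin_numD => /andP[].
move: h; rewrite E -(fineK fS) -(fineK fT) -EFinD !lte_fin.
lra.
Qed.

Lemma l1_int_tail (u : int -> R) (e : R) : l1 u -> 0 < e ->
  exists N, forall n, (N <= n)%N ->
    rsum (fun r => if (n < `|r|)%N then `|u r| else 0) < e.
Proof.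
move=> lu /(l1_tail lu)[A finA hA].
(* A finite set carrying all but [e] of the mass lies in a ball around 0, so the part outside the
   ball is smaller than [e]. *)
exists (\max_(r <- finmap.enum_fset (fset_set A)) `|r|%N) => n Nn; apply: le_lt_trans hA.
apply: ler_rsum.
- by apply: l1_le lu => r; case: ifP => _; rewrite ?normr0 ?normr_id.
- by apply: l1_le lu => r; case: ifP => _; rewrite ?normr0 ?normr_id.
- move=> r; case: ifP => [nr|_]; case: ifP => // rA.
  suff : (`|r| <= n)%N by rewrite leqNgt nr.
  by apply: leq_trans Nn; rewrite leq_bigmax_seq// in_fset_set.
Qed.

End AbsoluteSums.

(** * Absolutely summable complex families and the series of the definitions *)

Section ComplexSums.
Context {R : realType}.
Implicit Types (I J : choiceType) (z w : R[i]).
Local Notation normc := Normc.normc.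
Local Notation Re := complex.Re.
Local Notation Im := complex.Im.

Lemma ler_Re_normc z : `|Re z| <= normc z.
Proof.
case: z => a b /=; rewrite -(sqrtr_sqr a) ler_wsqrtr// lerDl; exact: sqr_ge0.
Qed.

Lemma ler_Im_normc z : `|Im z| <= normc z.
Proof.
case: z => a b /=; rewrite -(sqrtr_sqr b) ler_wsqrtr// lerDr; exact: sqr_ge0.
Qed.

Lemma normc_ge0 z : 0 <= normc z.
Proof. by case: z => a b; exact: sqrtr_ge0. Qed.

Lemma normc_real (x : R) : normc x%:C = `|x|.
Proof. by rewrite /= expr0n/= addr0 sqrtr_sqr. Qed.

Lemma normc_sqr_conj z : z * conjc z = (normc z ^+ 2)%:C.
Proof.
case: z => a b /=; rewrite sqr_sqrtr ?addr_ge0 ?sqr_ge0//.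
by apply/eqP; rewrite eq_complex /=; apply/andP; split; apply/eqP; ring.
Qed.

Lemma normc_sum (J : Type) (r : seq J) (P : pred J) (u : J -> R[i]) :
  normc (\sum_(j <- r | P j) u j) <= \sum_(j <- r | P j) normc (u j).
Proof.
elim: r => [|j r ih]; first by rewrite !big_nil Normc.normc0.
rewrite !big_cons; case: ifP => // _.
by apply: le_trans (le_normcD _ _) _; exact: lerD.
Qed.

Definition cl1 I (u : I -> R[i]) := l1 (fun i => normc (u i)).

Definition csum I (u : I -> R[i]) : R[i] :=
  rsum (fun i => Re (u i)) +i* rsum (fun i => Im (u i)).

Lemma cl1_Re I (u : I -> R[i]) : cl1 u -> l1 (fun i => Re (u i)).
Proof.
by apply: l1_le => i; rewrite [leRHS]ger0_norm ?normc_ge0 ?ler_Re_normc.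
Qed.

Lemma cl1_Im I (u : I -> R[i]) : cl1 u -> l1 (fun i => Im (u i)).
Proof.
by apply: l1_le => i; rewrite [leRHS]ger0_norm ?normc_ge0 ?ler_Im_normc.
Qed.

Lemma cl1_le I (u : I -> R[i]) (v : I -> R) :
  (forall i, normc (u i) <= `|v i|) -> l1 v -> cl1 u.
Proof. by move=> uv; apply: l1_le => i; rewrite ger0_norm ?normc_ge0. Qed.

Lemma eq_csum I (u v : I -> R[i]) : u =1 v -> csum u = csum v.
Proof. by move=> uv; congr csum; apply/funext. Qed.

Lemma cl1D I (u v : I -> R[i]) : cl1 u -> cl1 v -> cl1 (fun i => u i + v i).
Proof.
move=> lu lv; apply: cl1_le (l1D lu lv) => i.
by rewrite ger0_norm ?addr_ge0 ?normc_ge0 ?le_normcD.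
Qed.

Lemma cl1Z I z (u : I -> R[i]) : cl1 u -> cl1 (fun i => z * u i).
Proof.
move=> /(l1Z (normc z)); apply: cl1_le => i.
by rewrite Normc.normcM ger0_norm// mulr_ge0 ?normc_ge0.
Qed.

Lemma csumD I (u v : I -> R[i]) : cl1 u -> cl1 v ->
  csum (fun i => u i + v i) = csum u + csum v.
Proof.
move=> lu lv; rewrite /csum.
rewrite (@eq_rsum _ _ _ (fun i => Re (u i) + Re (v i))); last first.
  by move=> i; case: (u i) (v i) => [? ?] [? ?].
rewrite (@eq_rsum _ _ (fun i => Im (u i + v i)) (fun i => Im (u i) + Im (v i))).
  by rewrite (rsumD (cl1_Re lu) (cl1_Re lv)) (rsumD (cl1_Im lu) (cl1_Im lv)).
by move=> i; case: (u i) (v i) => [? ?] [? ?].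
Qed.

Lemma csumZ I z (u : I -> R[i]) : cl1 u ->
  csum (fun i => z * u i) = z * csum u.
Proof.
move=> lu; have lr := cl1_Re lu; have li := cl1_Im lu; rewrite /csum.
rewrite (@eq_rsum _ _ _ (fun i => Re z * Re (u i) - Im z * Im (u i))); last first.
  by move=> i; case: z (u i) => [? ?] [? ?].
rewrite (@eq_rsum _ _ (fun i => Im (z * u i))
  (fun i => Re z * Im (u i) + Im z * Re (u i))); last first.
  by move=> i; case: z (u i) => [? ?] [? ?].
rewrite (rsumB (l1Z _ lr) (l1Z _ li)) (rsumD (l1Z _ li) (l1Z _ lr)).
by rewrite !(rsumZ _ lr) !(rsumZ _ li); case: z.
Qed.

Lemma csumZr I z (u : I -> R[i]) : cl1 u ->
  csum (fun i => u i * z) = csum u * z.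
Proof. by move=> lu; rewrite mulrC -csumZ//; apply: eq_csum => i; rewrite mulrC. Qed.

Lemma csum_0 I : csum (fun _ : I => 0 : R[i]) = 0.
Proof. by rewrite /csum/= !rsum_0. Qed.

Lemma cl1_sum I (J : Type) (r : seq J) (P : pred J) (u : J -> I -> R[i]) :
  (forall j, P j -> cl1 (u j)) -> cl1 (fun i => \sum_(j <- r | P j) u j i).
Proof.
move=> lu; apply: cl1_le (@l1_sum _ _ _ r P _ lu) => i.
by rewrite ger0_norm ?normc_sum// sumr_ge0// => j _; exact: normc_ge0.
Qed.

Lemma csum_sum I (J : Type) (r : seq J) (P : pred J) (u : J -> I -> R[i]) :
  (forall j, P j -> cl1 (u j)) ->
  csum (fun i => \sum_(j <- r | P j) u j i) = \sum_(j <- r | P j) csum (u j).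
Proof.
move=> lu; elim: r => [|j r ih].
  by rewrite big_nil -[RHS](csum_0 I); apply: eq_csum => i; rewrite big_nil.
rewrite big_cons; case: ifP => Pj.
  rewrite -ih -csumD; [|exact: lu|exact: cl1_sum].
  by apply: eq_csum => i; rewrite big_cons Pj.
by rewrite -ih; apply: eq_csum => i; rewrite big_cons Pj.
Qed.

Lemma csum_real I (u : I -> R) : csum (fun i => (u i)%:C) = (rsum u)%:C.
Proof. by rewrite /csum /= rsum_0. Qed.

Lemma csum_conj I (u : I -> R[i]) : cl1 u ->
  csum (fun i => conjc (u i)) = conjc (csum u).
Proof.
move=> lu; rewrite /csum /= -rsumN; last exact: cl1_Im.
by congr (_ +i* _); apply: eq_rsum => i; case: (u i).
Qed.

Lemma csum_bij I J (e : J -> I) (u : I -> R[i]) : bijective e ->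
  csum (u \o e) = csum u.
Proof.
move=> be; rewrite /csum -(rsum_bij (fun i => Re (u i)) be).
by rewrite -(rsum_bij (fun i => Im (u i)) be).
Qed.

Lemma csum_exchange I J (u : I -> J -> R[i]) : cl1 (fun k => u k.1 k.2) ->
  csum (fun i => csum (u i)) = csum (fun j => csum (u ^~ j)).
Proof.
move=> lu; rewrite /csum/=; congr (_ +i* _).
- by rewrite (@rsum_exchange _ _ _ (fun i j => Re (u i j)))//; exact: (cl1_Re lu).
- by rewrite (@rsum_exchange _ _ _ (fun i j => Im (u i j)))//; exact: (cl1_Im lu).
Qed.

Lemma csum_delta I (a : I) (u : I -> R[i]) :
  (forall i, i != a -> u i = 0) -> csum u = u a.
Proof.
move=> u0; rewrite /csum !(rsum_delta (a := a)); first by case: (u a).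
- by move=> i /u0 ->.
- by move=> i /u0 ->.
Qed.

Lemma csum_int (u : int -> R[i]) : cl1 u ->
  csum u = csum (u \o Posz) + csum (u \o Negz).
Proof.
move=> lu; rewrite {1}/csum (rsum_int (cl1_Re lu)) (rsum_int (cl1_Im lu)).
by [].
Qed.

Lemma cseriesE (u : nat -> R[i]) : cl1 u -> cseries u = csum u.
Proof.
move=> lu; rewrite /cseries (limn_series_rsum (cl1_Re lu)).
by rewrite (limn_series_rsum (cl1_Im lu)).
Qed.

End ComplexSums.

(** * Fourier series and convolution on the integers *)

Section RootsOfUnity.
Context {R : realType}.
Implicit Types x y : R.

Lemma cisD x y : cis (x + y) = cis x * cis y.
Proof.
rewrite /cis cosD sinD; apply/eqP; rewrite eq_complex /=.
by apply/andP; split; apply/eqP; ring.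
Qed.

Lemma cis0 : cis 0 = 1 :> R[i].
Proof. by rewrite /cis cos0 sin0. Qed.

Lemma cisN x : cis (- x) = conjc (cis x).
Proof. by rewrite /cis cosN sinN. Qed.

Lemma normc_cis x : Normc.normc (cis x) = 1.
Proof. by rewrite /= cos2Dsin2 sqrtr1. Qed.

Lemma cisMn x n : cis (n%:R * x) = cis x ^+ n.
Proof.
elim: n => [|n ih]; first by rewrite mul0r cis0.
by rewrite -natr1 mulrDl mul1r cisD ih exprSr.
Qed.

Lemma conjcM (z w : R[i]) : conjc (z * w) = conjc z * conjc w.
Proof. by rewrite rmorphM. Qed.

Lemma cis_2pi_nat n : cis (n%:R * (2 * pi)) = 1 :> R[i].
Proof.
rewrite cisMn (_ : 2 * pi = pi *+ 2); last by rewrite mulr_natl.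
by rewrite /cis cos2pi sin2pi expr1n.
Qed.

Lemma cis_2pi_int (d : int) : cis (d%:~R * (2 * pi)) = 1 :> R[i].
Proof.
case: d => n; first exact: cis_2pi_nat.
by rewrite NegzE mulrNz mulNr cisN cis_2pi_nat conjc1.
Qed.

(** By cos x = 1 - 2 sin^2(x/2), a value 1 would force sin(x/2) = 0, but x/2 lies strictly between 0
    and pi. *)
Lemma cis_neq1 x : 0 < x < 2 * pi -> cis x != 1.
Proof.
move=> /andP[x0 x2]; apply/eqP => -[cx _].
have : 0 < sin (x / 2) by apply: sin_gt0_pi; apply/andP; split; lra.
have := cos_mulr2n (x / 2); rewrite (_ : x / 2 *+ 2 = x); last first.
  by rewrite -mulr_natr; field.
rewrite cx cos2sin2 => h s; have := exprn_gt0 2 s; lra.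
Qed.

Lemma sum_cis_omega N (d : int) : (0 < N)%N ->
  \sum_(k < N) cis (d%:~R * omega k) =
  (if (N%:Z %| d)%Z then N%:R else 0) :> R[i].
Proof.
move=> N0; have NR : N%:R != 0 :> R by rewrite pnatr_eq0 -lt0n.
set z : R[i] := cis (d%:~R * (2 * pi) / N%:R).
have zE (k : 'I_N) : cis (d%:~R * omega k) = z ^+ k.+1.
  by rewrite /z -cisMn; congr cis; rewrite /omega; field.
under eq_bigr do rewrite zE.
case: ifPn => [/dvdzP[q dq]|Nd].
  have -> : z = 1.
    rewrite /z dq intrM (_ : _ / _ = q%:~R * (2 * pi)) ?cis_2pi_int//.
    by rewrite -pmulrn; field.
  by under eq_bigr do rewrite expr1n; rewrite sumr_const card_ord.
(* Reducing [d] modulo [N] brings the angle strictly between 0 and 2 pi; the sum is then geometric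
   with ratio z != 1 and z^N = 1. *)
have z1 : z != 1.
  have -> : z = cis ((d %% N)%Z%:~R * (2 * pi) / N%:R).
    rewrite /z {1}(divz_eq d N) intrD intrM -pmulrn.
    rewrite (_ : _ / _ = (d %/ N)%Z%:~R * (2 * pi) +
       (d %% N)%Z%:~R * (2 * pi) / N%:R); last by field.
    by rewrite cisD cis_2pi_int mul1r.
  have Nz : N%:Z != 0 by rewrite -lt0n in N0 *; lia.
  have m0 := modz_ge0 d Nz.
  have mN : (d %% N)%Z < N%:Z by apply: ltz_pmod; lia.
  have mn0 : (d %% N)%Z != 0 by apply: contra Nd => /eqP/dvdz_mod0P.
  have m1 : 0 < (d %% N)%Z by rewrite lt_neqAle eq_sym mn0.
  apply: cis_neq1; apply/andP; split.
    by rewrite divr_gt0 ?mulr_gt0 ?pi_gt0 ?ltr0n ?ltr0z.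
  rewrite ltr_pdivrMr ?ltr0n// mulrC ltr_pM2l ?mulr_gt0 ?pi_gt0//.
  by rewrite -[N%:R]/(N%:Z%:~R) ltr_int.
apply/eqP; have := subrX1 z N.
have -> : z ^+ N = 1.
  by rewrite /z -cisMn mulrCA divff// mulr1 cis_2pi_int.
rewrite subrr => /esym/eqP; rewrite mulf_eq0 subr_eq0 (negbTE z1)/= => /eqP s0.
by under eq_bigr do rewrite exprS; rewrite -mulr_sumr s0 mulr0.
Qed.

Lemma omega_itv N (k : 'I_N) : 0 <= (omega k : R) <= 2 * pi.
Proof.
have NR : 0 < N%:R :> R by rewrite ltr0n (leq_ltn_trans _ (ltn_ord k)).
have p0 : 0 <= 2 * pi :> R by rewrite mulr_ge0 ?pi_ge0.
rewrite /omega; apply/andP; split.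
  by apply: divr_ge0; [exact: mulr_ge0|exact: ltW].
by rewrite ler_pdivrMr// ler_wpM2l// ler_nat ltn_ord.
Qed.

End RootsOfUnity.

(** * The Banach algebra l1(Z), Fourier series and aliasing *)

Section IntSequences.
Context {R : realType}.
Implicit Types (u v g : int -> R) (w : R).

(* Half of the norm ||.||_0. *)
Definition nrm u : R := rsum (fun r => `|u r|).

Lemma nrm_ge0 u : l1 u -> 0 <= nrm u.
Proof. by move=> lu; apply: rsum_ge0 => //; exact: l1_norm. Qed.

Lemma ler_nrm u v : l1 v -> (forall r, `|u r| <= `|v r|) -> nrm u <= nrm v.
Proof.
move=> lv uv; apply: ler_rsum => //; last exact: l1_norm.
by apply/l1_norm/(l1_le uv).
Qed.

Lemma ler_nrm_term u r : l1 u -> `|u r| <= nrm u.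
Proof. by move=> lu; apply: (ler_term_rsum (u := fun r => `|u r|)) => //; exact: l1_norm. Qed.

Lemma ler_nrmD u v : l1 u -> l1 v ->
  nrm (fun r => u r + v r) <= nrm u + nrm v.
Proof.
move=> lu lv; rewrite /nrm -rsumD; try exact: l1_norm.
apply: ler_rsum => [||r]; last exact: ler_normD.
  by apply: l1_norm; exact: l1D.
by apply: l1D; exact: l1_norm.
Qed.

Lemma nrmZ (k : R) u : l1 u -> nrm (fun r => k * u r) = `|k| * nrm u.
Proof.
move=> lu; rewrite /nrm -rsumZ; last exact: l1_norm.
by apply: eq_rsum => r; rewrite normrM.
Qed.

Lemma cl1_fourier g w : l1 g ->
  cl1 (fun r : int => (g r)%:C * cis (r%:~R * w)).
Proof.
move=> lg; apply: cl1_le lg => r.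
by rewrite Normc.normcM normc_cis mulr1 normc_real.
Qed.

Lemma fourierE g w : l1 g ->
  fourier g w = csum (fun r : int => (g r)%:C * cis (r%:~R * w)).
Proof.
move=> lg; have lf := cl1_fourier w lg.
rewrite csum_int// /fourier !cseriesE//.
- by apply: (l1_inj (e := Negz)) lf => ? ? [].
- by apply: (l1_inj (e := Posz)) lf => ? ? [].
Qed.

Lemma eq_fourier u v w : u =1 v -> fourier u w = fourier v w.
Proof. by move=> /funext ->. Qed.

Lemma fourierD u v w : l1 u -> l1 v ->
  fourier (fun r => u r + v r) w = fourier u w + fourier v w.
Proof.
move=> lu lv; rewrite !fourierE//; last exact: l1D.
rewrite -csumD; [|exact: cl1_fourier|exact: cl1_fourier].
by apply: eq_csum => r; rewrite rmorphD mulrDl.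
Qed.

Lemma fourierZ k u w : l1 u ->
  fourier (fun r => k * u r) w = k%:C * fourier u w.
Proof.
move=> lu; rewrite !fourierE//; last exact: l1Z.
rewrite -csumZ; last exact: cl1_fourier.
by apply: eq_csum => r; rewrite rmorphM mulrA.
Qed.

(** For real sequences, the coefficient side of complex conjugation ([fourier_refl]). *)
Definition refl u (r : int) : R := u (- r).

Lemma bij_oppz : bijective (fun r : int => - r).
Proof. by exists (fun r : int => - r) => r; rewrite opprK. Qed.

Lemma l1_refl u : l1 u -> l1 (refl u).
Proof. by apply: (l1_inj (e := fun r : int => - r)); exact: bij_inj bij_oppz. Qed.

Lemma nrm_refl u : nrm (refl u) = nrm u.
Proof. by rewrite /nrm -(rsum_bij (fun r => `|u r|) bij_oppz). Qed.

Lemma fourier_refl u w : l1 u -> fourier (refl u) w = conjc (fourier u w).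
Proof.
move=> lu; rewrite !fourierE//; last exact: l1_refl.
rewrite -csum_conj; last exact: cl1_fourier.
rewrite -(csum_bij (fun r : int => conjc _) bij_oppz).
apply: eq_csum => r; rewrite /refl /comp conjcM conjc_real -cisN.
by rewrite mulrNz mulNr opprK.
Qed.

Definition zconv u v (r : int) : R := rsum (fun s : int => u s * v (r - s)).

Lemma bij_subz (s : int) : bijective (fun r : int => r - s).
Proof. by exists (fun r => r + s) => r; rewrite ?addrK ?subrK. Qed.

Lemma bij_zsub (r : int) : bijective (fun s : int => r - s).
Proof. by exists (fun s => r - s) => s; rewrite opprB addrC subrK. Qed.

Lemma l1_shift u (s : int) : l1 u -> l1 (fun r : int => u (r - s)).
Proof. by apply: (l1_inj (e := fun r : int => r - s)); exact: bij_inj (bij_subz s). Qed.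

Lemma rsum_shift u (s : int) : rsum (fun r : int => u (r - s)) = rsum u.
Proof. exact: (rsum_bij u (bij_subz s)). Qed.

Lemma l1_conv_pair u v : l1 u -> l1 v ->
  l1 (fun k : int * int => u k.1 * v (k.2 - k.1)).
Proof.
move=> lu lv; apply: l1_prod => [s|] /=.
  by apply: l1Z; exact: l1_shift.
apply: (@eq_l1 _ _ _ (fun s => `|u s| * nrm v)).
  move=> s; rewrite (@eq_rsum _ _ _ (fun r => `|u s| * `|v (r - s)|)).
    rewrite rsumZ; last by apply: l1_norm; exact: l1_shift.
    by rewrite (rsum_shift (fun r => `|v r|)).
  by move=> r; rewrite normrM.
by apply: l1Zr; exact: l1_norm.
Qed.

Lemma l1_conv_term u v r : l1 u -> l1 v -> l1 (fun s : int => u s * v (r - s)).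
Proof.
move=> lu lv; have := l1_swap (l1_conv_pair lu lv).
exact: (@l1_slice _ _ _ (fun k : int * int => u k.2 * v (k.1 - k.2)) r).
Qed.

Lemma l1_conv u v : l1 u -> l1 v -> l1 (zconv u v).
Proof.
move=> lu lv; have := l1_rsum_slice (l1_swap (l1_conv_pair lu lv)).
exact: eq_l1.
Qed.

Lemma nrm_conv u v : l1 u -> l1 v -> nrm (zconv u v) <= nrm u * nrm v.
Proof.
move=> lu lv; have lu' := l1_norm lu; have lv' := l1_norm lv.
have -> : nrm u * nrm v = rsum (zconv (fun r => `|u r|) (fun r => `|v r|)).
  rewrite /zconv -(@rsum_exchange _ _ _ (fun s r => `|u s| * `|v (r - s)|)); last first.
    exact: (l1_conv_pair lu' lv').
  rewrite {1}/nrm -rsumZr//; apply: eq_rsum => s.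
  rewrite rsumZ; last exact: (l1_shift s lv').
  by rewrite (rsum_shift (fun r => `|v r|)).
apply: ler_rsum.
- by apply: l1_norm; exact: l1_conv.
- exact: l1_conv.
- move=> r; apply: le_trans (ler_norm_rsum _) _; first exact: l1_conv_term.
  by rewrite le_eqVlt; apply/orP; left; apply/eqP/eq_rsum => s; rewrite normrM.
Qed.

Lemma fourier_conv u v w : l1 u -> l1 v ->
  fourier (zconv u v) w = fourier u w * fourier v w.
Proof.
move=> lu lv; rewrite !fourierE//; last exact: l1_conv.
pose h (r s : int) := (u s * v (r - s))%:C * cis (r%:~R * w).
transitivity (csum (fun r => csum (h r))).
  apply: eq_csum => r; rewrite csumZr ?csum_real//.
  by apply: cl1_le (l1_conv_term r lu lv) => s; rewrite normc_real.
have lh : cl1 (fun k => h k.1 k.2).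
  apply: cl1_le (l1_swap (l1_conv_pair lu lv)) => k.
  by rewrite Normc.normcM normc_cis mulr1 normc_real.
rewrite (csum_exchange lh) -csumZr; last exact: cl1_fourier.
apply: eq_csum => s; rewrite -csumZ; last exact: cl1_fourier.
rewrite -(csum_bij (fun r => _ * (_ * _)) (bij_subz s)).
apply: eq_csum => r; rewrite /h /= rmorphM.
rewrite (_ : r%:~R * w = s%:~R * w + (r - s)%:~R * w); last first.
  by rewrite -mulrDl -intrD addrC subrK.
by rewrite cisD mulrACA.
Qed.

(** What sampling at the N-th roots of unity retains of [u]: by [aliasE], the discrete Fourier
    coefficient of index [s] collects a whole residue class modulo [N]. *)
Definition alias (N : nat) u (s : int) : R :=
  rsum (fun r => if (N%:Z %| r - s)%Z then u r else 0).

Lemma l1_alias N u (s : int) : l1 u ->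
  l1 (fun r => if (N%:Z %| r - s)%Z then u r else 0).
Proof. by apply: l1_le => r; case: ifP => _; rewrite ?normr0. Qed.

Lemma aliasE N u (s : int) : (0 < N)%N -> l1 u ->
  \sum_(k < N) cis (- (s%:~R * omega k)) * fourier u (omega k) =
  N%:R * (alias N u s)%:C.
Proof.
move=> N0 lu.
transitivity (\sum_(k < N) csum (fun r : int => (u r)%:C * cis ((r - s)%:~R * omega k))).
  apply: eq_bigr => k _; rewrite fourierE// -csumZ; last exact: cl1_fourier.
  apply: eq_csum => r; rewrite mulrCA -cisD; congr (_ * cis _).
  by rewrite -mulNr -mulrDl addrC intrB.
rewrite -csum_sum => [|k _]; last first.
  by apply: cl1_le lu => r; rewrite Normc.normcM normc_cis mulr1 normc_real.
have lc : cl1 (fun r : int => (if (N%:Z %| r - s)%Z then u r else 0)%:C).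
  by apply: cl1_le (l1_alias N s lu) => r; rewrite normc_real.
rewrite /alias -csum_real -csumZ//.
apply: eq_csum => r; rewrite -mulr_sumr sum_cis_omega//.
by case: ifP => _; rewrite ?mulr0// mulrC.
Qed.

(** Let d = u - v. All aliases of d vanish, since its Fourier series vanishes at the sampling
    points. For N large the alias at [s] is d s plus terms from the tail of d, whose total is less
    than |d s| if d s != 0; this is a contradiction. *)
Lemma fourier_inj u v : l1 u -> l1 v ->
  (forall w, 0 <= w <= 2 * pi -> fourier u w = fourier v w) -> u =1 v.
Proof.
move=> lu lv uv s; apply/eqP; rewrite -subr_eq0.
pose d r := u r - v r; rewrite -/(d s).
apply/negPn/negP => ds0; have e0 : 0 < `|d s| by rewrite normr_gt0.
have ld : l1 d by exact: l1B.
have d0 w : 0 <= w <= 2 * pi -> fourier d w = 0.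
  move=> /uv uvw; rewrite /d fourierD//; last exact: l1N.
  rewrite (@eq_fourier (fun r => - v r) (fun r => -1 * v r)) => [|r]; last by rewrite mulN1r.
  by rewrite fourierZ// uvw rmorphN1 mulN1r subrr.
have [M hM] := l1_int_tail ld e0.
(* With this N, any r != s congruent to s modulo N satisfies |r| >= N - |s| > M and so falls in the
   tail. *)
pose N := (M + `|s|).+1.
have N0 : (0 < N)%N by [].
have : N%:R * (alias N d s)%:C = 0 :> R[i].
  rewrite -aliasE// big1// => k _; rewrite d0 ?mulr0//; exact: omega_itv.
move=> /eqP; rewrite mulf_eq0 pnatr_eq0/= => /eqP[al0].
pose D r := if r == s then d s else 0.
have lD : l1 D by apply: (@l1_delta _ _ s) => r; rewrite /D => /negbTE ->.
have la := l1_alias N s ld.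
have ds : rsum D = d s by rewrite (@rsum_delta _ _ s) /D ?eqxx// => r /negbTE ->.
have := hM M (leqnn _); apply/negP; rewrite -leNgt.
have -> : `|d s| = `|rsum D - alias N d s| by rewrite al0 subr0 ds.
rewrite -rsumB//.
have lB := l1B lD la.
apply: le_trans (ler_norm_rsum lB) _.
apply: ler_rsum; first exact: l1_norm.
  by apply: l1_le ld => r; case: ifP => _; rewrite ?normr0 ?normr_id.
move=> r; rewrite /D; case: eqP => [->|/eqP rs].
  by rewrite subrr dvdz0 subrr normr0; case: ifP.
rewrite sub0r normrN; case: ifP => [/dvdzP[q rq]|_]; last by rewrite normr0; case: ifP.
rewrite ifT//.
have q0 : q != 0 by apply: contra rs => /eqP q0; rewrite -subr_eq0 rq q0 mul0r.
have : (`|r - s| >= N)%N by rewrite rq abszM absz_nat leq_pmull// absz_gt0.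
rewrite /N; lia.
Qed.

End IntSequences.

(** * Convolution identities, supports, and vectors as finitely supported sequences *)

Section ConvolutionAlgebra.
Context {R : realType}.
Implicit Types (u v h : int -> R) (A : pred int).

Definition delta (m r : int) : R := (r == m)%:R.

Lemma delta_neq m r : r != m -> delta m r = 0.
Proof. by rewrite /delta => /negbTE ->. Qed.

Lemma l1_deltaz m : l1 (delta m).
Proof. exact: (l1_delta (a := m)) (@delta_neq m). Qed.

Lemma fourier_delta m w : fourier (delta m) w = cis (m%:~R * w).
Proof.
rewrite fourierE; last exact: l1_deltaz.
rewrite (csum_delta (a := m)) /delta ?eqxx ?mul1r// => r /negbTE ->.
by rewrite mul0r.
Qed.

Lemma zconvC u v : l1 u -> l1 v -> zconv u v =1 zconv v u.
Proof.
move=> lu lv; apply: fourier_inj => [||w _]; try exact: l1_conv.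
by rewrite !fourier_conv// mulrC.
Qed.

Lemma zconvA u v h : l1 u -> l1 v -> l1 h ->
  zconv u (zconv v h) =1 zconv (zconv u v) h.
Proof.
move=> lu lv lh; have luv := l1_conv lu lv; have lvh := l1_conv lv lh.
apply: fourier_inj => [||w _]; try exact: l1_conv.
by rewrite !fourier_conv// mulrA.
Qed.

Lemma zconv_delta u m : l1 u -> zconv (delta m) u =1 (fun r => u (r - m)).
Proof.
move=> lu r; rewrite /zconv (rsum_delta (a := m)) /delta ?eqxx ?mul1r// => s /negbTE ->.
by rewrite mul0r.
Qed.

Lemma refl_zconv u v : l1 u -> l1 v ->
  refl (zconv u v) =1 zconv (refl u) (refl v).
Proof.
move=> lu lv; have lu' := l1_refl lu; have lv' := l1_refl lv.
apply: fourier_inj => [||w _]; [exact/l1_refl/l1_conv|exact: l1_conv|].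
by rewrite (fourier_refl _ (l1_conv lu lv)) !fourier_conv// conjcM !fourier_refl.
Qed.

Lemma reflK u : refl (refl u) =1 u.
Proof. by move=> r; rewrite /refl opprK. Qed.

Lemma eq_zconv u u' v v' : u =1 u' -> v =1 v' -> zconv u v =1 zconv u' v'.
Proof. by move=> /funext -> /funext ->. Qed.

Lemma zconvDr u v h : l1 u -> l1 v -> l1 h ->
  zconv u (fun r => v r + h r) =1 (fun r => zconv u v r + zconv u h r).
Proof.
move=> lu lv lh r; rewrite /zconv -rsumD; try exact: l1_conv_term.
by apply: eq_rsum => s; rewrite mulrDr.
Qed.

Lemma zconvZl (k : R) u v : l1 u -> l1 v ->
  zconv (fun r => k * u r) v =1 (fun r => k * zconv u v r).
Proof.
move=> lu lv r; rewrite /zconv -rsumZ; last exact: l1_conv_term.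
by apply: eq_rsum => s; rewrite mulrA.
Qed.

Definition rst A u (r : int) : R := if A r then u r else 0.

Lemma l1_rst A u : l1 u -> l1 (rst A u).
Proof. by apply: l1_le => r; rewrite /rst; case: ifP => _; rewrite ?normr0. Qed.

Lemma nrm_rst A u : l1 u -> nrm (rst A u) <= nrm u.
Proof.
by move=> lu; apply: ler_nrm => // r; rewrite /rst; case: ifP => _; rewrite ?normr0.
Qed.

Definition supp_le (m : int) u := forall r, m < r -> u r = 0.
Definition supp_ge (m : int) u := forall r, r < m -> u r = 0.

Lemma zconv_eq0 u v r : (forall s : int, u s != 0 -> v (r - s) = 0) ->
  zconv u v r = 0.
Proof.
move=> h; rewrite -[RHS](rsum_0 int); apply: eq_rsum => s.
by have [->|/h ->] := eqVneq (u s) 0; rewrite ?mul0r ?mulr0.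
Qed.

Lemma zconv_supp_le m k u v : supp_le m u -> supp_le k v ->
  supp_le (m + k) (zconv u v).
Proof.
move=> um vk r mkr; apply: zconv_eq0 => s us; apply: vk.
have : s <= m by rewrite leNgt; apply/negP => /um us0; rewrite us0 eqxx in us.
by lia.
Qed.

Lemma zconv_supp_ge m k u v : supp_ge m u -> supp_ge k v ->
  supp_ge (m + k) (zconv u v).
Proof.
move=> um vk r mkr; apply: zconv_eq0 => s us; apply: vk.
have : m <= s by rewrite leNgt; apply/negP => /um us0; rewrite us0 eqxx in us.
by lia.
Qed.

Lemma supp_le_refl m u : supp_le m u -> supp_ge (- m) (refl u).
Proof. by move=> um r rm; apply: um; rewrite ltrNr. Qed.

Lemma rsum_ord n u : supp_ge 1 u -> supp_le n%:Z u ->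
  rsum u = \sum_(t < n) u t.+1%:Z.
Proof.
move=> u1 un; pose e (t : 'I_n) (r : int) := if r == t.+1%:Z then u t.+1%:Z else 0.
have e0 (t : 'I_n) r : r != t.+1%:Z -> e t r = 0 by rewrite /e => /negbTE ->.
transitivity (rsum (fun r => \sum_(t < n) e t r)).
  apply: eq_rsum => r.
  have [r1|r1] := ltP r 1.
    rewrite u1// big1// => t _; apply: e0; apply: contraTneq r1 => ->; lia.
  have [rn|rn] := ltP n%:Z r.
    rewrite un// big1// => t _; apply: e0; apply: contraTneq rn => ->.
    by have := ltn_ord t; lia.
  have rn' : (`|r|.-1 < n)%N by lia.
  have re : r = (Ordinal rn').+1%:Z by rewrite /=; lia.
  rewrite (bigD1 (Ordinal rn'))//= big1 => [|t tr]; last first.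
    apply: e0; rewrite re; apply: contra tr => /eqP[tr].
    by apply/eqP/val_inj; rewrite /= tr.
  by rewrite /e -re eqxx addr0.
rewrite rsum_sum => [|t _]; last exact: l1_delta (e0 t).
by apply: eq_bigr => t _; rewrite (rsum_delta (e0 t)) /e eqxx.
Qed.

Definition ext n (x : 'cV[R]_n) (r : int) : R :=
  \sum_(t < n) (if r == t.+1%:Z then x t 0 else 0).

Lemma ext_ord n (x : 'cV[R]_n) (t : 'I_n) : ext x t.+1%:Z = x t 0.
Proof.
rewrite /ext (bigD1 t)//= eqxx big1 ?addr0// => s st; rewrite ifF//.
by apply/negbTE; apply: contra st => /eqP[ts]; apply/eqP/val_inj.
Qed.

Lemma ext_supp_ge n (x : 'cV[R]_n) : supp_ge 1 (ext x).
Proof. by move=> r r1; rewrite /ext big1// => t _; rewrite ifF//; lia. Qed.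

Lemma ext_supp_le n (x : 'cV[R]_n) : supp_le n%:Z (ext x).
Proof.
by move=> r r1; rewrite /ext big1// => t _; rewrite ifF//; have := ltn_ord t; lia.
Qed.

Lemma l1_ext n (x : 'cV[R]_n) : l1 (ext x).
Proof.
apply: l1_sum => t _; apply: (l1_delta (a := t.+1%:Z)) => r /negbTE.
by move=> ->.
Qed.

Lemma zconv_ext n c (x : 'cV[R]_n) r : l1 c ->
  zconv c (ext x) r = \sum_(t < n) c (r - t.+1%:Z) * x t 0.
Proof.
move=> lc; rewrite zconvC//; last exact: l1_ext.
rewrite /zconv (@rsum_ord n).
- by apply: eq_bigr => t _; rewrite ext_ord mulrC.
- by move=> s s1; rewrite ext_supp_ge ?mul0r.
- by move=> s s1; rewrite ext_supp_le ?mul0r.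
Qed.

Lemma nrm_ext n (x : 'cV[R]_n) : nrm (ext x) = \sum_(t < n) `|x t 0|.
Proof.
rewrite /nrm (@rsum_ord n).
- by apply: eq_bigr => t _; rewrite ext_ord.
- by move=> s s1; rewrite ext_supp_ge ?normr0.
- by move=> s s1; rewrite ext_supp_le ?normr0.
Qed.

(** Turns inner products into convolutions, so that quadratic forms can be rearranged by
    associativity. *)
Lemma zconv_refl0 u v : l1 u -> l1 v ->
  zconv (refl u) v 0 = rsum (fun r => u r * v r).
Proof.
move=> lu lv; rewrite /zconv -(rsum_bij _ bij_oppz); apply: eq_rsum => r.
by rewrite /refl /= sub0r !opprK.
Qed.

End ConvolutionAlgebra.

(** * Toeplitz matrices and Baxter's inequality *)

Section Stability.
Context {R : realType}.
(** To be read as: [a] and [p] are the coefficients of phi_f and psi_f, supported on r <= 0 because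
    of the sign in e^{-ij omega}; [c] is the autocovariance and [s2] the innovation variance. The
    reflected sequences are supported on r >= 0. *)
Variables (a p c : int -> R) (s2 : R).
Hypotheses (la : l1 a) (lp : l1 p) (lc : l1 c) (s2_gt0 : 0 < s2).
Hypotheses (a0 : supp_le 0 a) (p0 : supp_le 0 p).
Hypothesis zconv_ap : zconv a p =1 delta 0.
Hypothesis zconv_pp : c =1 (fun r => s2 * zconv p (refl p) r).
Hypothesis c_even : forall r, c (- r) = c r.

Let la' := l1_refl la.
Let lp' := l1_refl lp.

Lemma zconv_apK u : l1 u -> zconv a (zconv p u) =1 u.
Proof.
move=> lu r; rewrite zconvA// (eq_zconv zconv_ap (frefl u)) zconv_delta//.
by rewrite subr0.
Qed.

Lemma zconv_refl_ap : zconv (refl p) (refl a) =1 delta 0.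
Proof.
move=> r; rewrite -refl_zconv// /refl zconvC// zconv_ap /delta.
by rewrite oppr_eq0.
Qed.

Lemma zconv_refl_paK u : l1 u -> zconv (refl p) (zconv (refl a) u) =1 u.
Proof.
move=> lu r; rewrite zconvA// (eq_zconv zconv_refl_ap (frefl u)) zconv_delta//.
by rewrite subr0.
Qed.

Lemma zconv_refl_apK u : l1 u -> zconv (refl a) (zconv (refl p) u) =1 u.
Proof.
move=> lu r; rewrite zconvA// (eq_zconv (zconvC la' lp') (frefl u)).
by rewrite (eq_zconv zconv_refl_ap (frefl u)) zconv_delta// subr0.
Qed.

Lemma zconv_cE u : l1 u -> zconv c u =1 (fun r => s2 * zconv p (zconv (refl p) u) r).
Proof.
move=> lu r; rewrite (eq_zconv zconv_pp (frefl u)) zconvZl//; last exact: l1_conv.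
by rewrite zconvA.
Qed.

(** [refl a] cancels the factor [refl p] of [c]. What remains is a multiple of [p], which is
    supported on r <= 0 and hence does not extend a support to the right. *)
Lemma zconv_refl_a_c u : l1 u ->
  zconv (refl a) (zconv c u) =1 (fun r => s2 * zconv p u r).
Proof.
move=> lu r; rewrite (eq_zconv (frefl (refl a)) (zconv_cE lu)).
have lpu := l1_conv lp' lu; have lppu := l1_conv lp lpu.
rewrite zconvC//; last exact: l1Z.
rewrite zconvZl// zconvC//; congr (_ * _).
rewrite (eq_zconv (frefl (refl a)) (zconvA lp lp' lu)).
rewrite (eq_zconv (frefl (refl a)) (eq_zconv (zconvC lp lp') (frefl u))).
rewrite (eq_zconv (frefl (refl a)) (fsym (zconvA lp' lp lu))).
by rewrite zconv_refl_apK//; exact: l1_conv.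
Qed.

Section Outside.
Variables (n : nat) (x : int -> R).
Hypotheses (lx : l1 x) (xn : supp_le n%:Z x).

Let y := zconv c x.
Let ly : l1 y. Proof. exact: l1_conv. Qed.
Let L := rst (fun r => r < 1) y.
Let M := rst (fun r => 1 <= r <= n%:Z) y.
Let Q := rst (fun r => n%:Z < r) y.
Let lL : l1 L. Proof. exact: l1_rst. Qed.
Let lM : l1 M. Proof. exact: l1_rst. Qed.
Let lQ : l1 Q. Proof. exact: l1_rst. Qed.
Let e := rsum (fun r => if (n < `|r|)%N then `|a r| else 0).

Lemma zconv_c_split : y =1 (fun r => L r + (M r + Q r)).
Proof.
move=> r; rewrite /L /M /Q /rst; have [r1|r1] := ltP r 1.
  by rewrite /= ifF ?addr0//; lia.
by rewrite /= add0r; have [rn|rn] := ltP n%:Z r; rewrite ?addr0 ?add0r.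
Qed.

(* refl a * y = s2 p * x vanishes beyond n, so on that side the part Q of y is
   determined by L and M, and L only enters through the coefficients of a beyond n. *)
Lemma nrm_right : nrm Q <= nrm p * (e * nrm L + nrm a * nrm M).
Proof.
have laL := l1_conv la' lL; have laM := l1_conv la' lM.
have laQ := l1_conv la' lQ; have lMQ := l1D lM lQ.
have px : supp_le n%:Z (zconv p x) by rewrite -[n%:Z]add0r; exact: zconv_supp_le.
have aQ : supp_ge (n%:Z + 1) (zconv (refl a) Q).
  rewrite -[_ + 1]add0r; apply: zconv_supp_ge.
    by rewrite -oppr0; exact: supp_le_refl.
  by move=> r rn; rewrite /Q /rst ifF//; lia.
pose k := rst (fun r => (n < `|r|)%N) (refl a).
have lk : l1 k by exact: l1_rst.
have ke : nrm k = e.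
  rewrite /nrm /e -(rsum_bij _ bij_oppz); apply: eq_rsum => r.
  by rewrite /k /rst /refl /= opprK abszN; case: ifP; rewrite ?normr0.
have aL r : n%:Z < r -> zconv (refl a) L r = zconv k L r.
  move=> rn; apply: eq_rsum => s; rewrite /k /rst; case: ifPn => // ns.
  by rewrite /L /rst ifF ?mulr0 ?mul0r//; lia.
have dec r : `|zconv (refl a) Q r| <= `| `|zconv k L r| + `|zconv (refl a) M r| |.
  have [rn|rn] := leP r n%:Z; first by rewrite aQ ?normr0//; lia.
  have := zconv_refl_a_c lx r; rewrite -/y px// mulr0.
  rewrite (eq_zconv (frefl (refl a)) zconv_c_split) zconvDr// zconvDr// aL// => h.
  have -> : zconv (refl a) Q r = - (zconv k L r + zconv (refl a) M r) by lra.
  by rewrite normrN [leRHS]ger0_norm ?addr_ge0//; exact: ler_normD.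
have lkL := l1_conv lk lL.
have aQb : nrm (zconv (refl a) Q) <= e * nrm L + nrm a * nrm M.
  apply: le_trans (ler_nrm (l1D (l1_norm lkL) (l1_norm laM)) dec) _.
  apply: le_trans (ler_nrmD (l1_norm lkL) (l1_norm laM)) _.
  rewrite /nrm; under eq_rsum do rewrite normr_id.
  under [X in _ + X <= _]eq_rsum do rewrite normr_id.
  by rewrite -!/(nrm _) -ke -(nrm_refl a) lerD// nrm_conv.
apply: le_trans (_ : nrm p * nrm (zconv (refl a) Q) <= _); last first.
  by apply: ler_wpM2l => //; exact: nrm_ge0.
rewrite -(nrm_refl p); apply: le_trans _ (nrm_conv lp' laQ).
by apply: ler_nrm => [|r]; [exact: l1_conv|rewrite zconv_refl_paK].
Qed.

End Outside.

Section OutsideBound.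
Variables (n : nat) (x : int -> R).
Hypotheses (lx : l1 x) (x1 : supp_ge 1 x) (xn : supp_le n%:Z x).

Let y := zconv c x.
Let ly : l1 y. Proof. exact: l1_conv. Qed.
Let L := rst (fun r => r < 1) y.
Let M := rst (fun r => 1 <= r <= n%:Z) y.
Let Q := rst (fun r => n%:Z < r) y.
Let lL : l1 L. Proof. exact: l1_rst. Qed.
Let lM : l1 M. Proof. exact: l1_rst. Qed.
Let lQ : l1 Q. Proof. exact: l1_rst. Qed.
Let e := rsum (fun r => if (n < `|r|)%N then `|a r| else 0).

Let flip u (r : int) : R := u (n%:Z + 1 - r).

Let l1_flip u : l1 u -> l1 (flip u).
Proof.
by apply: (l1_inj (e := fun r => n%:Z + 1 - r)); exact: bij_inj (bij_zsub _).
Qed.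

Let nrm_flip u : nrm (flip u) = nrm u.
Proof. by rewrite /nrm -(rsum_bij (fun r => `|u r|) (bij_zsub (n%:Z + 1))). Qed.

Let zconv_flip u : zconv c (flip u) =1 flip (zconv c u).
Proof.
move=> r; rewrite /zconv /flip /zconv -[RHS](rsum_bij _ bij_oppz).
by apply: eq_rsum => s /=; rewrite c_even; congr (_ * u _); lia.
Qed.

(** This is [nrm_right] for the reversed sequence: r -> n + 1 - r preserves 1..n, exchanges the two
    outer parts, and commutes with convolution by the even sequence [c]. *)
Lemma nrm_left : nrm L <= nrm p * (e * nrm Q + nrm a * nrm M).
Proof.
have fxn : supp_le n%:Z (flip x) by move=> r rn; apply: x1; lia.
have := nrm_right (l1_flip lx) fxn.
rewrite (_ : rst _ _ = flip L); last first.
  by apply/funext => r; rewrite /rst zconv_flip /L /flip /rst; congr (if _ then _ else _); lia.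
rewrite (_ : rst _ _ = flip Q); last first.
  by apply/funext => r; rewrite /rst zconv_flip /Q /flip /rst; congr (if _ then _ else _); lia.
rewrite (_ : rst _ _ = flip M); last first.
  by apply/funext => r; rewrite /rst zconv_flip /M /flip /rst; congr (if _ then _ else _); lia.
by rewrite !nrm_flip.
Qed.

(** In the sum of [nrm_left] and [nrm_right] the outer parts reappear with factor at most 1/2 and
    are absorbed, which doubles 2 |p| |a| into the 4. So the middle part controls all of y = c * x,
    and x is recovered as s2^-1 a * refl a * y. *)
Lemma nrm_le_inside : nrm p * e <= 2^-1 ->
  nrm x <= s2^-1 * nrm a ^+ 2 * (1 + 4 * (nrm p * nrm a)) * nrm M.
Proof.
move=> pe.
have hL := nrm_left; have hQ := nrm_right lx xn; rewrite -/y -/L -/M -/Q -/e in hQ.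
have pL := nrm_ge0 lL; have pQ := nrm_ge0 lQ; have pM := nrm_ge0 lM.
have hLQ : nrm L + nrm Q <= 4 * (nrm p * nrm a) * nrm M.
  have : nrm p * e * (nrm L + nrm Q) <= 2^-1 * (nrm L + nrm Q).
    by rewrite ler_wpM2r// addr_ge0.
  lra.
have hy : nrm y <= (1 + 4 * (nrm p * nrm a)) * nrm M.
  have lMQ := l1D lM lQ.
  have : nrm y <= nrm L + (nrm M + nrm Q).
    apply: le_trans (_ : nrm L + nrm (fun r => M r + Q r) <= _); last first.
      by rewrite lerD2l; exact: ler_nrmD.
    apply: le_trans _ (ler_nrmD lL lMQ).
    have -> // : nrm y = nrm (fun r => L r + (M r + Q r)).
    by apply/eq_rsum => r; congr `|_|; exact: (zconv_c_split n x r).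
  lra.
have xE : x =1 (fun r => s2^-1 * zconv a (zconv (refl a) y) r).
  move=> r; rewrite (eq_zconv (frefl a) (zconv_refl_a_c lx)).
  have lpx := l1_conv lp lx.
  rewrite zconvC//; last exact: l1Z.
  rewrite zconvZl// zconvC// zconv_apK// mulrA mulVf ?mul1r//.
  exact: lt0r_neq0.
have lay := l1_conv la' ly.
have -> : nrm x = s2^-1 * nrm (zconv a (zconv (refl a) y)).
  rewrite -{1}(gtr0_norm (x := s2^-1)) ?invr_gt0// -nrmZ; last exact: l1_conv.
  by congr nrm; apply/funext.
rewrite -!mulrA; apply: ler_wpM2l; first by rewrite invr_ge0 ltW.
apply: le_trans (nrm_conv la lay) _; rewrite ler_wpM2l ?nrm_ge0//.
apply: le_trans (nrm_conv la' ly) _; rewrite nrm_refl.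
by rewrite ler_wpM2l ?nrm_ge0.
Qed.

End OutsideBound.

(** * Positive definiteness and uniform l1 stability of the Toeplitz matrices *)

Definition toep n : 'M[R]_n := \matrix_(s, t) c (s.+1%:Z - t.+1%:Z).

Lemma toepE n (x : 'cV[R]_n) (s : 'I_n) :
  (toep n *m x) s 0 = zconv c (ext x) s.+1%:Z.
Proof. by rewrite zconv_ext// mxE; apply: eq_bigr => t _; rewrite mxE. Qed.

(** The form is the value at 0 of refl x * c * x; substituting c = s2 p * refl p groups it as refl h
    * h with h = refl p * x, that is, as a squared l2 norm. *)
Lemma toep_quad n (x : 'cV[R]_n) :
  \sum_(s < n) x s 0 * (toep n *m x) s 0 =
  s2 * rsum (fun r => zconv (refl p) (ext x) r ^+ 2).
Proof.
have lx := l1_ext x; have lh := l1_conv lp' lx; have lph := l1_conv lp lh.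
transitivity (rsum (fun r => ext x r * zconv c (ext x) r)).
  rewrite (@rsum_ord _ n).
  - by apply: eq_bigr => s _; rewrite toepE ext_ord.
  - by move=> r r1; rewrite ext_supp_ge ?mul0r.
  - by move=> r r1; rewrite ext_supp_le ?mul0r.
have lcx := l1_conv lc lx.
rewrite -zconv_refl0// (eq_zconv (frefl _) (zconv_cE lx)).
have lrx := l1_refl lx.
rewrite zconvC//; last exact: l1Z.
rewrite zconvZl// zconvC// zconvA// -zconv_refl0//; congr (_ * _).
apply: eq_zconv => //; apply: fsym.
move=> r; rewrite refl_zconv// zconvC//; last exact: l1_refl.
by apply: eq_zconv => //; exact: reflK.
Qed.

Lemma l1_sqr (u : int -> R) : l1 u -> l1 (fun r : int => u r ^+ 2).
Proof.
move=> lu; apply: (l1_le (v := fun r => nrm u * u r)); last exact: l1Z.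
move=> r; rewrite expr2 !normrM ler_wpM2r// [leRHS]ger0_norm ?nrm_ge0//.
exact: ler_nrm_term.
Qed.

Lemma toep_quad_ge0 n (x : 'cV[R]_n) :
  0 <= \sum_(s < n) x s 0 * (toep n *m x) s 0.
Proof.
rewrite toep_quad mulr_ge0 ?(ltW s2_gt0)//; apply: rsum_ge0 => [r|].
  exact: sqr_ge0.
by apply/l1_sqr/l1_conv => //; exact: l1_ext.
Qed.

(** Definiteness: a vanishing form kills refl p * x, from which [refl a] recovers x. *)
Lemma toep_quad_le0 n (x : 'cV[R]_n) :
  \sum_(s < n) x s 0 * (toep n *m x) s 0 <= 0 -> x = 0.
Proof.
move=> x0; have lx := l1_ext x; have lh := l1_conv lp' lx.
have /eqP : \sum_(s < n) x s 0 * (toep n *m x) s 0 = 0.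
  by apply/eqP; rewrite eq_le x0 toep_quad_ge0.
rewrite toep_quad mulf_eq0 (gt_eqF s2_gt0)/= => /eqP.
move=> /(rsum_eq0 (l1_sqr lh) (fun r => sqr_ge0 _)) h0.
apply/colP => t; rewrite mxE -ext_ord -(zconv_refl_apK lx).
apply: zconv_eq0 => s _; apply/eqP; rewrite -sqrf_eq0; apply/eqP.
exact: h0.
Qed.

Lemma toep_sym n : (toep n)^T = toep n.
Proof. by apply/matrixP => s t; rewrite !mxE -c_even opprB. Qed.

Lemma toep_unit n : toep n \in unitmx.
Proof.
rewrite -row_free_unit; apply: inj_row_free => v vT0.
apply: trmx_inj; rewrite trmx0; apply: toep_quad_le0.
have -> : toep n *m v^T = 0 by rewrite -toep_sym -trmx_mul vT0 trmx0.
by rewrite big1// => s _; rewrite [X in _ * X]mxE mulr0.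
Qed.

Lemma toep_stable_large : exists2 C : R, 0 <= C & exists N, forall n (x : 'cV[R]_n),
  (N <= n)%N -> \sum_(t < n) `|x t 0| <= C * \sum_(s < n) `|(toep n *m x) s 0|.
Proof.
have na := nrm_ge0 la; have np := nrm_ge0 lp.
exists (s2^-1 * nrm a ^+ 2 * (1 + 4 * (nrm p * nrm a))).
  rewrite mulr_ge0// ?mulr_ge0 ?invr_ge0 ?exprn_ge0 ?(ltW s2_gt0)//.
  by rewrite addr_ge0 ?mulr_ge0.
(* A tail of [a] below this threshold meets the smallness condition of [nrm_le_inside]; the + 1
   keeps the denominator positive. *)
have e0 : 0 < 2^-1 / (nrm p + 1) :> R by rewrite divr_gt0// ?invr_gt0 ?ltr0n; lra.
have [N hN] := l1_int_tail la e0; exists N => n x Nn.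
have lx := l1_ext x.
rewrite -nrm_ext; apply: le_trans (nrm_le_inside lx _ _ _) _.
- exact: ext_supp_ge.
- exact: ext_supp_le.
- have := hN n Nn; rewrite ltr_pdivlMr; last lra.
  set e := rsum _ => h.
  have : 0 <= e.
    apply: rsum_ge0 => [r|]; first by case: ifP.
    by apply: l1_le la => r; case: ifP => _; rewrite ?normr0 ?normr_id.
  lra.
- rewrite le_eqVlt; apply/orP; left; apply/eqP; congr (_ * _).
  rewrite /nrm (@rsum_ord _ n).
  + apply: eq_bigr => s _; rewrite toepE /rst ifT//.
    by have := ltn_ord s; lia.
  + by move=> r r1; rewrite /rst ifF ?normr0//; lia.
  + by move=> r r1; rewrite /rst ifF ?normr0//; lia.
Qed.

Lemma toep_bounded_below n : exists2 C : R, 0 <= C & forall x : 'cV[R]_n,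
  \sum_(t < n) `|x t 0| <= C * \sum_(s < n) `|(toep n *m x) s 0|.
Proof.
exists (\sum_(t < n) \sum_(s < n) `|invmx (toep n) t s|).
  by rewrite sumr_ge0// => t _; rewrite sumr_ge0.
move=> x; rewrite {1}(_ : x = invmx (toep n) *m (toep n *m x)); last first.
  by rewrite mulKmx// toep_unit.
rewrite mulr_suml; apply: ler_sum => t _; rewrite mxE.
apply: le_trans (ler_norm_sum _ _ _) _; rewrite mulr_suml.
apply: ler_sum => s _; rewrite normrM ler_wpM2l//.
rewrite (bigD1 s)//= lerDl; exact: sumr_ge0.
Qed.

Lemma toep_stable : exists2 C : R, 0 <= C & forall n (x : 'cV[R]_n),
  \sum_(t < n) `|x t 0| <= C * \sum_(s < n) `|(toep n *m x) s 0|.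
Proof.
have [C0 C0_ge0 [N hN]] := toep_stable_large.
have /choice[C hC] : forall n, exists C : R, 0 <= C /\ forall x : 'cV[R]_n,
    \sum_(t < n) `|x t 0| <= C * \sum_(s < n) `|(toep n *m x) s 0|.
  by move=> n; have [C] := toep_bounded_below n; exists C.
have sC n : 0 <= \sum_(k < n) C k by apply: sumr_ge0 => k _; case: (hC k).
(* The sum of nonnegative constants serves as a common bound: [C0] for n >= N, and the term [C n]
   for n < N. *)
exists (C0 + \sum_(k < N) C k) => [|n x]; first exact: addr_ge0.
have S0 : 0 <= \sum_(s < n) `|(toep n *m x) s 0| by exact: sumr_ge0.
have [Nn|nN] := leqP N n.
  by apply: le_trans (hN n x Nn) _; rewrite ler_wpM2r// lerDl.
apply: le_trans ((hC n).2 x) _; rewrite ler_wpM2r//.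
rewrite (bigD1 (Ordinal nN))//= addrCA lerDl addr_ge0// sumr_ge0// => k _.
by case: (hC k).
Qed.

(** * Normal equations for the finite predictor *)

Section Prediction.
Variable n : nat.
Implicit Types (x b : 'cV[R]_n) (tau : int).

Definition pred_rhs tau : 'cV[R]_n := \col_s c (tau - s.+1%:Z).

Definition pred_sol tau : 'cV[R]_n := invmx (toep n) *m pred_rhs tau.

Lemma toep_pred_sol tau : toep n *m pred_sol tau = pred_rhs tau.
Proof. by rewrite mulKVmx// toep_unit. Qed.

Lemma mseE tau x : mse c tau x = c 0 -
  2 * (\sum_(t < n) x t 0 * pred_rhs tau t 0) +
  \sum_(s < n) x s 0 * (toep n *m x) s 0.
Proof.
rewrite /mse; congr (_ - 2 * _ + _).
  by apply: eq_bigr => t _; rewrite mxE.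
apply: eq_bigr => s _; rewrite mxE mulr_sumr; apply: eq_bigr => t _.
by rewrite mxE mulrAC mulrA.
Qed.

Lemma toep_bilin_sym x b :
  \sum_(s < n) x s 0 * (toep n *m b) s 0 = \sum_(s < n) b s 0 * (toep n *m x) s 0.
Proof.
transitivity (\sum_(s < n) \sum_(t < n) x s 0 * (toep n s t * b t 0)).
  by apply: eq_bigr => s _; rewrite mxE mulr_sumr.
rewrite exchange_big/=; apply: eq_bigr => t _; rewrite mxE mulr_sumr.
apply: eq_bigr => s _; rewrite -{1}toep_sym [in LHS]mxE.
by rewrite mulrC -mulrA mulrCA.
Qed.

(** Completing the square around the solution of the normal equations; the cross terms cancel by
    symmetry of the Toeplitz matrix. *)
Lemma mse_pred_sol tau b : mse c tau b =
  mse c tau (pred_sol tau) + \sum_(s < n)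
    (b - pred_sol tau) s 0 * (toep n *m (b - pred_sol tau)) s 0.
Proof.
set z := pred_sol tau; rewrite !mseE.
have zE : pred_rhs tau = toep n *m z by rewrite toep_pred_sol.
have -> : \sum_(s < n) (b - z) s 0 * (toep n *m (b - z)) s 0 =
   \sum_(s < n) b s 0 * (toep n *m b) s 0 - \sum_(s < n) b s 0 * (toep n *m z) s 0
   - (\sum_(s < n) z s 0 * (toep n *m b) s 0 - \sum_(s < n) z s 0 * (toep n *m z) s 0).
  rewrite -!sumrB; apply: eq_bigr => s _; rewrite mulmxBr.
  set u := toep n *m b; set v := toep n *m z; rewrite !mxE; ring.
rewrite (toep_bilin_sym z b) zE; ring.
Qed.

(** [xget] returns some minimiser, since the solution of the normal equations is one. By
    [mse_pred_sol] its excess error is a definite form in the difference, so the two coincide. *)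
Lemma best_predE tau : best_pred n c tau = pred_sol tau.
Proof.
rewrite /best_pred; set S := [set a | _].
have zS : S (pred_sol tau).
  by move=> b; rewrite [leRHS]mse_pred_sol lerDl toep_quad_ge0.
have /(_ (pred_sol tau)) := xgetPex 0 (ex_intro S _ zS).
set b := xget _ _; rewrite [leLHS]mse_pred_sol gerDl => /toep_quad_le0.
by move/eqP; rewrite subr_eq0 => /eqP.
Qed.

Lemma toep_best_pred tau : toep n *m best_pred n c tau = pred_rhs tau.
Proof. by rewrite best_predE toep_pred_sol. Qed.

(** Time reversal: as [c] is even, reversing rows and columns leaves the Toeplitz matrix unchanged,
    and the two right-hand sides are reversals of each other. This reduces tau > n to tau <= 0. *)
Lemma pred_coef_rev tau (t : 'I_n) :
  pred_coef c (n.+1%:Z - tau) t = pred_coef c tau (rev_ord t).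
Proof.
rewrite /pred_coef; have -> : best_pred n c (n.+1%:Z - tau) =
    \col_s best_pred n c tau (rev_ord s) 0; last by rewrite mxE.
apply: (can_inj (mulKmx (toep_unit n))); rewrite toep_best_pred.
apply/colP => s; rewrite !mxE.
have /colP/(_ (rev_ord s)) := toep_best_pred tau; rewrite !mxE.
rewrite (reindex_inj rev_ord_inj)/= => h.
transitivity (c (tau - (rev_ord s).+1%:Z)).
  by rewrite -c_even; congr c; rewrite /=; have := ltn_ord s; lia.
rewrite -h; apply: eq_bigr => t' _; rewrite !mxE; congr (_ * _).
rewrite -c_even; congr c; rewrite /=.
by have := ltn_ord s; have := ltn_ord t'; lia.
Qed.

(** As a function of tau the coefficient is a finite combination of translates of [c], with weights
    from the inverse Toeplitz matrix. Hence the series over tau in [Dmx] and [Jhat] converge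
    absolutely. *)
Lemma l1_pred_coef (e : nat -> int) (t : 'I_n) : injective e ->
  l1 (fun m => pred_coef c (e m) t).
Proof.
move=> inje; rewrite /pred_coef.
apply: (eq_l1 (v := fun m => \sum_(s < n) invmx (toep n) t s * c (e m - s.+1%:Z))).
  by move=> m; rewrite best_predE mxE; apply: eq_bigr => s _; rewrite mxE.
apply: l1_sum => s _; apply: l1Z.
by apply: (l1_inj (e := fun m => e m - s.+1%:Z)) lc => m m' /addIr/inje.
Qed.

End Prediction.

(** * Prediction from a half line, and Baxter's inequality *)

Section InfinitePast.
Implicit Types (m n : nat) (t : int).

Let past m := rst (fun r => r <= 0) (fun r => p (- m%:Z - r)).

Let l1_past m : l1 (past m).
Proof. by apply/l1_rst; apply: l1_inj lp; exact: bij_inj (bij_zsub _). Qed.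

(* The error filter of the best predictor of X_{-m} from all X_t, t >= 1: by
   [pred_err_past] and [pred_errE] it is delta_{-m} - sum_t phi_t(-m) delta_t with
   phi_t(-m) = sum_{j <= m} phi_{t+j} psi_{m-j}.  Cutting the shifted psi at 0 before
   convolving with phi makes c * pred_err vanish on the positive half line. *)
Definition pred_err m := zconv (refl a) (past m).

Lemma l1_pred_err m : l1 (pred_err m).
Proof. exact: l1_conv. Qed.

(** Without the cut at 0 the filter would be refl a * refl p * delta_{-m} = delta_{-m}. The removed
    piece lives on r >= 1, and [refl a], supported on r >= 0, cannot move it back to r <= 0. *)
Lemma pred_err_past m (r : int) : r <= 0 -> pred_err m r = delta (- m%:Z) r.
Proof.
move=> r0; pose s := fun r => p (- m%:Z - r).
have ls : l1 s by apply: l1_inj lp; exact: bij_inj (bij_zsub _).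
pose future := rst (fun r => 0 < r) s.
have lf : l1 future by exact: l1_rst.
have sE : s =1 zconv (refl p) (delta (- m%:Z)).
  move=> k; rewrite zconvC//; last exact: l1_deltaz.
  by rewrite zconv_delta// /refl /s; congr p; lia.
have sD : s =1 (fun k => past m k + future k).
  move=> k; rewrite /past /future /rst.
  by have [k0|k0] := leP k 0; rewrite ?addr0 ?add0r.
have := zconv_refl_apK (l1_deltaz (- m%:Z)) r.
rewrite -(eq_zconv (frefl _) sE) (eq_zconv (frefl _) sD) zconvDr//.
suff -> : zconv (refl a) future r = 0 by rewrite addr0.
have := @zconv_supp_ge R 0 1 (refl a) future; apply; last lia.
  by rewrite -oppr0; exact: supp_le_refl.
by move=> k k1; rewrite /future /rst ifF//; lia.
Qed.

(** Orthogonality of the prediction error to X_s for s >= 1: c * pred_err reduces to s2 p * past, a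
    product of two sequences supported on r <= 0. *)
Lemma zconv_c_pred_err m (s : int) : 0 < s -> zconv c (pred_err m) s = 0.
Proof.
move=> s0; rewrite zconv_cE ?(eq_zconv (frefl _) (zconv_refl_paK (l1_past m))).
  rewrite (@zconv_supp_le R 0 0 p (past m)) ?mulr0//.
  by move=> k k1; rewrite /past /rst ifF//; lia.
exact: l1_pred_err.
Qed.

(* The coefficients of phi_t^infty. *)
Definition tail_coef t := rst (fun r => r <= 0) (fun r => - a (r - t)).

Lemma l1_tail_coef t : l1 (tail_coef t).
Proof. by apply/l1_rst/l1N/l1_shift. Qed.

(** The same sum seen from the frequency side: phi_t(-m) is the Fourier coefficient of index -m of
    phi_t^infty / phi, the quotient that appears in D_infty. *)
Lemma pred_errE m t : pred_err m t = - zconv (tail_coef t) p (- m%:Z).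
Proof.
rewrite /pred_err zconvC// /zconv -rsumN; last first.
  by apply: l1_conv_term => //; exact: l1_tail_coef.
apply: eq_rsum => r; rewrite /past /tail_coef /rst /refl opprB.
by case: ifP => _; rewrite ?mulNr ?opprK ?mul0r ?oppr0// mulrC.
Qed.

Lemma tail_coef_supp_le t : supp_le 0 (tail_coef t).
Proof. by move=> r r0; rewrite /tail_coef /rst ifF//; lia. Qed.

Lemma zconv_tail_supp_le t : supp_le 0 (zconv (tail_coef t) p).
Proof.
by rewrite -[0]addr0; apply: zconv_supp_le => //; exact: tail_coef_supp_le.
Qed.

(* phi_{t,n}(-m; f) - phi_t(-m; f) *)
Definition coef_diff n m (t : 'I_n) : R :=
  pred_coef c (- m%:Z) t + pred_err m t.+1%:Z.

(** Split [pred_err] into its mass at -m, its part on 1..n and its part beyond n. Orthogonality says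
    that the three images under [c] cancel at s; the finite normal equations cancel the first, which
    leaves the part beyond n as the only source term. *)
Lemma toep_coef_diff n m (s : 'I_n) :
  (toep n *m \col_t coef_diff m t) s 0 =
  - zconv c (rst (fun r => n%:Z < r) (pred_err m)) s.+1%:Z.
Proof.
have lw := l1_pred_err m; have lQ := l1_rst (fun r => n%:Z < r) lw.
pose x : 'cV[R]_n := \col_t pred_err m t.+1%:Z; have lx := l1_ext x.
have -> : \col_t coef_diff m t = best_pred n c (- m%:Z) + x.
  by apply/colP => t; rewrite !mxE.
rewrite mulmxDr mxE toep_best_pred toepE mxE.
have wE : pred_err m =1 (fun r => delta (- m%:Z) r +
    (ext x r + rst (fun r => n%:Z < r) (pred_err m) r)).
  move=> r; rewrite /rst; have [r0|r0] := leP r 0.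
    by rewrite pred_err_past// ext_supp_ge ?ifF ?addr0//; lia.
  rewrite delta_neq ?add0r; last by lia.
  have [rn|rn] := ltP n%:Z r; first by rewrite ext_supp_le ?add0r.
  have rn' : (`|r|.-1 < n)%N by lia.
  have re : r = (Ordinal rn').+1%:Z by rewrite /=; lia.
  by rewrite addr0 {2}re ext_ord mxE -re.
have := @zconv_c_pred_err m s.+1%:Z isT.
rewrite (eq_zconv (frefl c) wE) zconvDr//; last 2 first.
- exact: l1_deltaz.
- exact: l1D.
rewrite zconvDr// zconvC//; last exact: l1_deltaz.
rewrite zconv_delta// => h.
suff : c (- m%:Z - s.+1%:Z) = c (s.+1%:Z - - m%:Z) by lra.
by rewrite -c_even; congr c; lia.
Qed.

Lemma sum_ord_le_nrm n (u : int -> R) : l1 u ->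
  \sum_(s < n) `|u s.+1%:Z| <= nrm u.
Proof.
move=> lu; apply: le_trans (nrm_rst (fun r => 1 <= r <= n%:Z) lu).
rewrite /nrm (@rsum_ord _ n).
- apply: ler_sum => s _; rewrite /rst ifT//.
  by have := ltn_ord s; lia.
- by move=> r r1; rewrite /rst ifF ?normr0//; lia.
- by move=> r r1; rewrite /rst ifF ?normr0//; lia.
Qed.

Lemma baxter : exists2 C : R, 0 <= C & forall n m,
  \sum_(t < n) `|coef_diff m t| <=
  C * nrm (rst (fun r => n%:Z < r) (pred_err m)).
Proof.
have [C C0 hC] := toep_stable; exists (C * nrm c).
  by rewrite mulr_ge0 ?nrm_ge0.
move=> n m; have := hC n (\col_t coef_diff m t).
under eq_bigr do rewrite mxE.
move=> /le_trans; apply; rewrite -mulrA ler_wpM2l//.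
under eq_bigr do rewrite toep_coef_diff normrN.
have lQ := l1_rst (fun r => n%:Z < r) (l1_pred_err m).
by apply: le_trans (nrm_conv lc lQ); apply: sum_ord_le_nrm; exact: l1_conv.
Qed.

Lemma nsum_exchange (u : nat -> nat -> R) : (forall i j, 0 <= u i j) ->
  (\esum_(i in setT) nsum (u i) = \esum_(j in setT) nsum (u ^~ j))%E.
Proof.
move=> u0; rewrite -(@nsum_prod _ _ _ (fun k => u k.1 k.2))//.
rewrite -(@nsum_prod _ _ _ (fun k => u k.2 k.1))//.
rewrite -(nsum_bij (e := fun k : nat * nat => (k.2, k.1)))//.
by exists (fun k => (k.2, k.1)) => -[].
Qed.

(** Each k = i + j arises from the k + 1 indices i <= k, hence the weight. *)
Lemma nsum_triangle (x : nat -> R) : (forall k, 0 <= x k) ->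
  (\esum_(i in setT) nsum (fun j => x (i + j)%N) <=
   nsum (fun k => k.+1%:R * x k)%R)%E.
Proof.
move=> x0; pose y i k := if (i <= k)%N then x k else 0.
have y0 i k : 0 <= y i k by rewrite /y; case: ifP.
apply: (@le_trans _ _ (\esum_(i in setT) nsum (y i))%E).
  apply: le_esum => i _.
  rewrite (@eq_nsum _ _ _ (y i \o addn i)) => [|j]; last by rewrite /y /= leq_addr.
  by apply: nsum_inj => //; exact: addnI.
rewrite nsum_exchange//; apply: le_esum => k _.
rewrite (@eq_nsum _ nat _ (fun i : nat => \sum_(l < k.+1) if i == l :> nat then x k else 0)).
  rewrite /nsum; under eq_esum do rewrite -sumEFin.
  rewrite esum_sum => [|i l _ _]; last by rewrite lee_fin; case: ifP.
  rewrite (eq_bigr (fun=> (x k)%:E)) => [|l _].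
    by rewrite sumEFin lee_fin sumr_const card_ord mulr_natl.
  by rewrite -/(nsum _) (nsum_delta (a := nat_of_ord l)) ?eqxx// => i /negbTE ->.
move=> i; rewrite /y; case: ifPn => [ik|ik].
  rewrite (bigD1 (Ordinal (ik : i < k.+1)%N))//= eqxx big1 ?addr0// => l li.
  by rewrite ifF//; apply/negbTE; apply: contra li => /eqP il; apply/eqP/val_inj.
rewrite big1// => l _; rewrite ifF//; apply/negbTE; apply: contra ik => /eqP ->.
by rewrite -ltnS.
Qed.

Lemma nrm_tail_coef t : 0 < t ->
  (nrm (tail_coef t))%:E = nsum (fun j : nat => `|a (- (t + j%:Z))|).
Proof.
move=> t0; rewrite /nrm -nsum_rsum//; last first.
  by apply/l1_norm; exact: l1_tail_coef.
rewrite -(nsum_bij _ bij_oppz) nsum_int//; last by move=> r /=.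
rewrite [X in (_ + X)%E](@eq_nsum _ _ _ (fun=> 0)) => [|j]; last first.
  by rewrite /= tail_coef_supp_le ?normr0// NegzE; lia.
rewrite [X in (_ + X)%E]esum1// adde0; apply: eq_nsum => j /=.
by rewrite /tail_coef /rst ifT ?normrN; [congr `|a _|; lia|lia].
Qed.

(** After exchanging the sums, for fixed t = n + 1 + i the sum over m is part of the l1 norm of
    tail_coef t * p. Its bound is |p| times a tail of [a] starting at t, and summing these tails
    over i gives the triangular weight k + 1 = u - n at u = n + 1 + k. *)
Lemma nsum_tail_pred_err n :
  (nsum (fun m => nrm (rst (fun r => (n%:Z < r)%R) (pred_err m))) <=
   (nrm p)%:E * nsum (fun k => k.+1%:R * `|a (- (n.+1 + k)%N%:Z)|)%R)%E.
Proof.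
have -> : nsum (fun m => nrm (rst (fun r => (n%:Z < r)%R) (pred_err m))) =
    (\esum_(m in setT) nsum (fun i => `|pred_err m (n.+1 + i)%N%:Z|%R))%E.
  apply: eq_esum.
  move=> m _; set u := rst _ _.
  have lu : l1 u by apply/l1_rst; exact: l1_pred_err.
  rewrite /nrm -nsum_rsum//; last exact: l1_norm.
  have shift : bijective (fun r : int => r + n.+1%:Z).
    by exists (fun r => r - n.+1%:Z) => r; rewrite ?addrK ?subrK.
  rewrite -(nsum_bij _ shift) nsum_int; last by move=> r /=.
  rewrite [X in (_ + X)%E](@eq_nsum _ _ _ (fun=> 0)) => [|j]; last first.
    by rewrite /= /u /rst ifF ?normr0//; lia.
  rewrite [X in (_ + X)%E]esum1// adde0; apply: eq_nsum => j /=.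
  by rewrite /u /rst ifT; [congr `|pred_err m _|; lia|lia].
rewrite nsum_exchange//.
apply: (@le_trans _ _ (\esum_(i in setT)
    nsum (fun j => nrm p * `|a (- (n.+1 + (i + j))%N%:Z)|)%R)%E); last first.
  rewrite -nsum_pZ ?nrm_ge0//.
  apply: le_trans (nsum_triangle (x := fun k => nrm p * `|a (- (n.+1 + k)%N%:Z)|) _) _.
    by move=> k; rewrite mulr_ge0 ?nrm_ge0.
  by apply: le_nsum => k; rewrite mulrCA.
apply: le_esum => i _; set t := (n.+1 + i)%N%:Z.
have lq := l1_tail_coef t.
apply: (@le_trans _ _ (nrm p * nrm (tail_coef t))%:E).
  rewrite (@eq_nsum _ _ _ ((fun r => `|zconv (tail_coef t) p r|) \o (fun m : nat => - m%:Z))).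
    apply: le_trans (nsum_inj _ _) _ => //; first by move=> x y /oppr_inj[].
    rewrite nsum_rsum//; last exact/l1_norm/l1_conv.
    by rewrite lee_fin mulrC; exact: nrm_conv.
  by move=> m; rewrite pred_errE normrN.
have t0 : 0 < t by rewrite /t; lia.
rewrite EFinM (nrm_tail_coef t0) -(nsum_pZ (nrm_ge0 lp)) => [|j]; last exact: normr_ge0.
by apply: le_nsum => j; rewrite /t -PoszD addnA.
Qed.

End InfinitePast.

(** * From coefficient differences to the matrices and the quadratic form *)

Section Matrices.
Variable phi : nat -> R.
Hypothesis aE : forall j, a (- j.+1%:Z) = - phi j.+1.
Hypothesis fourier_p : forall w, fourier p w = (ar_fun phi w)^-1.

(** Index m of [u] is placed at the frequency tau = -m. *)
Definition nonpos (u : nat -> R) (r : int) : R := if r <= 0 then u `|r|%N else 0.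

Lemma nsum_nonpos (u : nat -> R) : (forall m, 0 <= u m) -> nsum (nonpos u) = nsum u.
Proof.
move=> u0; rewrite -(nsum_bij _ bij_oppz) nsum_int; last first.
  by move=> r /=; rewrite /nonpos; case: ifP.
rewrite [X in (_ + X)%E](@eq_nsum _ _ _ (fun=> 0))//.
rewrite [X in (_ + X)%E]esum1// adde0; apply: eq_nsum => m /=.
by rewrite /nonpos ifT; [congr u; lia|lia].
Qed.

Lemma abssum_nonpos (u : nat -> R) : abssum (nonpos u) = abssum u.
Proof.
rewrite /abssum -nsum_nonpos//; apply: eq_nsum => r; rewrite /nonpos.
by case: ifP; rewrite ?normr0.
Qed.

Lemma l1_nonpos u : l1 u -> l1 (nonpos u).
Proof. by rewrite /l1 abssum_nonpos. Qed.

Lemma nrm_nonpos u : l1 u -> nrm (nonpos u) = rsum (fun m => `|u m|).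
Proof.
move=> lu; apply: EFin_inj; rewrite /nrm -abssum_rsum ?abssum_nonpos//.
  exact: abssum_rsum.
exact: l1_nonpos.
Qed.

Lemma cl1_cis (u : nat -> R) (e : nat -> R) : l1 u ->
  cl1 (fun m => (u m)%:C * cis (e m)).
Proof.
by move=> lu; apply: cl1_le lu => m; rewrite Normc.normcM normc_cis mulr1 normc_real.
Qed.

Lemma fourier_nonpos u w : l1 u ->
  fourier (nonpos u) w = csum (fun m => (u m)%:C * cis (- (m%:R * w))).
Proof.
move=> lu; have ln := l1_nonpos lu; have lf := cl1_fourier w ln.
rewrite fourierE// -(csum_bij _ bij_oppz) csum_int; last first.
  by apply: (l1_inj (e := fun r : int => - r)) lf; exact: bij_inj bij_oppz.
rewrite [X in _ + X](@eq_csum _ _ _ (fun=> 0)) => [|j]; last first.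
  by rewrite /comp /nonpos /= mul0r.
rewrite csum_0 addr0; apply: eq_csum => m /=.
rewrite /nonpos ifT; last lia.
by rewrite mulrNz mulNr -pmulrn; congr ((u _)%:C * _); lia.
Qed.

Lemma conj_fourier_nonpos u w : l1 u ->
  conjc (fourier (nonpos u) w) = csum (fun m => (u m)%:C * cis (m%:R * w)).
Proof.
move=> lu; rewrite fourier_nonpos// -csum_conj; last exact: cl1_cis.
by apply: eq_csum => m; rewrite conjcM conjc_real -cisN opprK.
Qed.

Let oppz_inj : injective (fun m : nat => - m%:Z).
Proof. by move=> m m' /oppr_inj[]. Qed.

Lemma l1_coef_diff n (t : 'I_n) : l1 (fun m => coef_diff m t).
Proof.
apply: l1D; first exact: l1_pred_coef oppz_inj.
apply: (@eq_l1 _ _ _ ((fun r => - zconv (tail_coef t.+1%:Z) p r) \o (fun m : nat => - m%:Z))).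
  by move=> m; rewrite pred_errE.
apply: l1_inj => //; apply: l1N; apply: l1_conv => //; exact: l1_tail_coef.
Qed.

Lemma nonpos_coef_diff n (t : 'I_n) : nonpos (fun m => coef_diff m t) =1
  (fun r => nonpos (fun m => pred_coef c (- m%:Z) t) r
            + (-1) * zconv (tail_coef t.+1%:Z) p r).
Proof.
move=> r; rewrite /nonpos; case: ifPn => [r0|r0]; last first.
  by rewrite zconv_tail_supp_le ?mulr0 ?addr0//; lia.
by rewrite /coef_diff pred_errE mulN1r (_ : - `|r|%N%:Z = r)//; lia.
Qed.

Lemma phi_infE n (t : 'I_n) w :
  phi_inf phi t w = fourier (tail_coef t.+1%:Z) w.
Proof.
have phiE s : phi (t.+1 + s)%N = tail_coef t.+1%:Z (- s%:Z).
  rewrite /tail_coef /rst ifT; last lia.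
  by rewrite (_ : - s%:Z - t.+1%:Z = - (t + s).+1%:Z) ?aE ?opprK ?addSn//; lia.
have lphi : l1 (fun s => phi (t.+1 + s)%N).
  apply: (eq_l1 phiE); apply: (l1_inj (e := fun s : nat => - s%:Z)) => //.
  exact: l1_tail_coef.
rewrite (@eq_fourier _ _ (nonpos (fun s => phi (t.+1 + s)%N))).
  by rewrite fourier_nonpos// /phi_inf cseriesE//; exact: cl1_cis.
move=> r; rewrite /nonpos phiE; case: ifPn => r0; first by congr tail_coef; lia.
by rewrite tail_coef_supp_le//; lia.
Qed.

(* Up to the factor n^{-1/2}, the Fourier coefficients of column t of
   D_n(f) - D_{infty,n}(f): the terms with tau <= 0 occupy the nonpositive
   frequencies and those with tau > n the positive ones. *)
Definition gap_coef n (t : 'I_n) (r : int) : R :=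
  nonpos (fun m => coef_diff m t) r +
  zconv (delta 1) (refl (nonpos (fun m => coef_diff m (rev_ord t)))) r.

Lemma l1_nonpos_coef_diff n (t : 'I_n) : l1 (nonpos (fun m => coef_diff m t)).
Proof. by apply: l1_nonpos; exact: l1_coef_diff. Qed.

Lemma l1_gap_coef n (t : 'I_n) : l1 (gap_coef t).
Proof.
apply: l1D; first exact: l1_nonpos_coef_diff.
by apply: l1_conv; [exact: l1_deltaz|apply: l1_refl; exact: l1_nonpos_coef_diff].
Qed.

Lemma nrm_gap_coef n (t : 'I_n) : nrm (gap_coef t) <=
  rsum (fun m => `|coef_diff m t|) + rsum (fun m => `|coef_diff m (rev_ord t)|).
Proof.
have l0 := l1_nonpos_coef_diff t; have l0' := l1_nonpos_coef_diff (rev_ord t).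
have lr := l1_refl l0'; have ld := @l1_deltaz R 1.
rewrite /gap_coef; apply: le_trans (ler_nrmD l0 (l1_conv ld lr)) _.
rewrite nrm_nonpos; last exact: l1_coef_diff.
rewrite lerD2l; apply: le_trans (nrm_conv ld lr) _.
rewrite nrm_refl nrm_nonpos; last exact: l1_coef_diff.
rewrite /nrm (rsum_delta (a := 1)) => [|r /delta_neq ->]; last by rewrite normr0.
by rewrite /delta eqxx normr1 mul1r.
Qed.

(** With tau = -m the exponent -(tau - 1) is 1 + m, so the second half is e^{i omega} times the
    conjugate of a series of the first kind, as in [DinfE]. *)
Lemma DmxE n (k t : 'I_n) : Dmx n c k t = isqrtn n *
  (fourier (nonpos (fun m => pred_coef c (- m%:Z) t)) (omega k) +
   cis (omega k) *
   conjc (fourier (nonpos (fun m => pred_coef c (- m%:Z) (rev_ord t))) (omega k))).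
Proof.
have lt := l1_pred_coef t oppz_inj; have lr := l1_pred_coef (rev_ord t) oppz_inj.
rewrite mxE; congr (_ * _).
rewrite conj_fourier_nonpos// fourier_nonpos// -csumZ; last exact: cl1_cis.
have l2 := cl1Z (cis (omega k)) (cl1_cis (fun m => m%:R * omega k) lr).
have l3 := cl1_cis (fun m => - (m%:R * omega k)) lt.
rewrite -csumD// -cseriesE; last exact: cl1D.
congr cseries; apply/funext => m; congr (_ * cis _ + _).
  by rewrite mulrNz mulNr -pmulrn.
rewrite [RHS]mulrCA -cisD; congr (_ * cis _).
by rewrite intrB mulrNz opprB opprK mulrDl mul1r -pmulrn.
Qed.

Lemma DinfE n (k t : 'I_n) : Dinf n phi k t = isqrtn n *
  (fourier (zconv (tail_coef t.+1%:Z) p) (omega k) +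
   cis (omega k) *
   conjc (fourier (zconv (tail_coef (rev_ord t).+1%:Z) p) (omega k))).
Proof.
rewrite mxE !phi_infE !fourier_conv//; try exact: l1_tail_coef.
by rewrite !fourier_p conjcM conjc_inv -[in LHS]mulrA -mulrDr.
Qed.

Lemma D_diffE n (k t : 'I_n) : (Dmx n c - Dinf n phi) k t =
  isqrtn n * fourier (gap_coef t) (omega k).
Proof.
rewrite [LHS]mxE [X in _ + X]mxE DmxE DinfE -mulrBr; congr (_ * _).
have l0 := l1_nonpos_coef_diff t; have l0' := l1_nonpos_coef_diff (rev_ord t).
have lr := l1_refl l0'; have ld := @l1_deltaz R 1.
have fE (t' : 'I_n) w : fourier (nonpos (fun m => coef_diff m t')) w =
    fourier (nonpos (fun m => pred_coef c (- m%:Z) t')) w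
    - fourier (zconv (tail_coef t'.+1%:Z) p) w.
  have lz := l1_conv (l1_tail_coef t'.+1%:Z) lp.
  rewrite (eq_fourier _ (nonpos_coef_diff t')) fourierD; last 2 first.
  - by apply: l1_nonpos; exact: l1_pred_coef oppz_inj.
  - exact: l1Z.
  by rewrite fourierZ// rmorphN1 mulN1r.
rewrite [fourier (gap_coef t) _](fourierD _ l0 (l1_conv ld lr)).
rewrite (fourier_conv _ ld lr) fourier_delta (fourier_refl _ l0') !fE mul1r.
rewrite (rmorphB conjc) mulrBr opprD addrACA; congr (_ + _).
Qed.

(** The indices 1..n are distinct modulo n, so every r contributes to at most one of the aliases. *)
Lemma sum_alias_le n (u : int -> R) : (0 < n)%N -> l1 u ->
  \sum_(s < n) `|alias n u s.+1%:Z| <= nrm u.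
Proof.
move=> n0 lu.
have ll (s : 'I_n) : l1 (fun r => if (n%:Z %| r - s.+1%:Z)%Z then `|u r| else 0).
  exact/l1_alias/l1_norm.
apply: (@le_trans _ _ (\sum_(s < n) alias n (fun r => `|u r|) s.+1%:Z)).
  apply: ler_sum => s _; apply: le_trans (ler_norm_rsum (l1_alias _ _ lu)) _.
  rewrite le_eqVlt; apply/orP; left; apply/eqP/eq_rsum => r.
  by case: ifP; rewrite ?normr0.
rewrite /alias -rsum_sum//; apply: ler_rsum => [||r]; [exact: l1_sum|exact: l1_norm|].
have [/existsP[s0 hs0]|/existsPn no] :=
    boolP [exists s : 'I_n, (n%:Z %| r - s.+1%:Z)%Z].
  rewrite (bigD1 s0)//= hs0 big1 ?addr0// => s ss0; rewrite ifF//.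
  apply/negbTE; apply: contra ss0 => hs.
  have : (n%:Z %| s0%:Z - s%:Z)%Z.
    by rewrite (_ : _ - _ = (r - s.+1%:Z) - (r - s0.+1%:Z)); [exact: rpredB|lia].
  move=> /dvdzP[q hq]; apply/eqP/val_inj/eqP => /=.
  have [q0|q0] := eqVneq q 0; first by move: hq; rewrite q0; lia.
  have := ltn_ord s; have := ltn_ord s0; nia.
by rewrite big1// => s _; rewrite ifF//; exact/negbTE/no.
Qed.

Lemma isqrtn_sqr n : (0 < n)%N -> isqrtn n * isqrtn n = (n%:R)^-1 :> R[i].
Proof.
move=> n0; rewrite /isqrtn -rmorphM -invfM -expr2 sqr_sqrtr ?ler0n//.
by rewrite fmorphV rmorph_nat.
Qed.

(** The two factors n^{-1/2}, from F and from D, make up the 1/n of the inverse discrete Fourier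
    transform in [aliasE]. *)
Lemma FDDE n (g : R -> R) h (s t : 'I_n) : (0 < n)%N -> l1 h ->
  (forall w, 0 <= w <= 2 * pi -> ((g w)^-1)%:C = fourier h w) ->
  FDD n g c phi s t = (alias n (zconv h (gap_coef t)) s.+1%:Z)%:C.
Proof.
move=> n0 lh gh; have lg := l1_gap_coef t; have lhg := l1_conv lh lg.
have nC : n%:R != 0 :> R[i] by rewrite pnatr_eq0 -lt0n.
apply: (mulfI nC); rewrite -aliasE// mxE mulr_sumr; apply: eq_bigr => k _.
rewrite D_diffE mul_mx_diag !mxE conjcM gh ?omega_itv// fourier_conv//.
rewrite /isqrtn conjc_real -/(isqrtn n) -cisN -pmulrn.
rewrite (_ : _ * _ = isqrtn n * isqrtn n *
   (cis (- (s.+1%:R * omega k)) * (fourier h (omega k) * fourier (gap_coef t) (omega k)))).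
  by rewrite isqrtn_sqr// mulVKf.
ring.
Qed.

Lemma norm1_FDD_le n (g : R -> R) h : (0 < n)%N -> l1 h ->
  (forall w, 0 <= w <= 2 * pi -> ((g w)^-1)%:C = fourier h w) ->
  norm1 (FDD n g c phi) <=
  nrm h * (2 * \sum_(t < n) rsum (fun m => `|coef_diff m t|)).
Proof.
move=> n0 lh gh; rewrite /norm1 exchange_big/=.
apply: (@le_trans _ _ (\sum_(t < n) nrm h * nrm (gap_coef t))).
  apply: ler_sum => t _; have lg := l1_gap_coef t.
  under eq_bigr do rewrite (FDDE _ _ n0 lh gh) normc_real.
  apply: le_trans (sum_alias_le n0 _) (nrm_conv lh lg).
  exact: l1_conv.
rewrite -mulr_sumr ler_wpM2l ?nrm_ge0//.
apply: le_trans (ler_sum _ (fun t _ => nrm_gap_coef t)) _.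
rewrite big_split/= [X in _ + X](reindex_inj rev_ord_inj)/=.
under [X in _ + X]eq_bigr do rewrite rev_ordK.
by rewrite mulr_natl mulr2n.
Qed.

(** [C] is quantified before n, g and h: it depends only on the factorisation of f, which later
    makes [eps] independent of n and f_theta. The 2 in it counts the two mirror halves of D. *)
Lemma norm1_FDD_bound : exists2 C : R, 0 <= C &
  forall n (g : R -> R) h, (0 < n)%N -> l1 h ->
  (forall w, 0 <= w <= 2 * pi -> ((g w)^-1)%:C = fourier h w) ->
  ((norm1 (FDD n g c phi))%:E <= (C * nrm h)%:E *
    nsum (fun k => k.+1%:R * `|a (- (n.+1 + k)%N%:Z)|)%R)%E.
Proof.
have [C C0 hC] := baxter; have np := nrm_ge0 lp.
exists (2 * C * nrm p) => [|n g h n0 lh gh]; first by rewrite !mulr_ge0.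
have nh := nrm_ge0 lh.
pose B m := nrm (rst (fun r => n%:Z < r) (pred_err m)).
have B0 m : 0 <= B m by apply: nrm_ge0; apply: l1_rst; exact: l1_pred_err.
apply: (@le_trans _ _ ((2 * nrm h)%:E * (C%:E * nsum B))%E); last first.
  rewrite [2 * C * _ * _](_ : _ = 2 * nrm h * (C * nrm p)); last by ring.
  rewrite [in leRHS]EFinM -muleA lee_wpmul2l ?lee_fin ?mulr_ge0//.
  by rewrite EFinM -muleA lee_wpmul2l ?lee_fin// nsum_tail_pred_err.
apply: (@le_trans _ _ ((2 * nrm h)%:E *
    (\sum_(t < n) rsum (fun m => `|coef_diff m t|))%:E)%E).
  rewrite -EFinM lee_fin; apply: le_trans (norm1_FDD_le n0 lh gh) _.
  by rewrite mulrCA mulrA.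
rewrite lee_wpmul2l ?lee_fin ?mulr_ge0// -nsum_pZ//.
have ld (t : 'I_n) : true -> l1 (fun m => `|coef_diff m t|).
  by move=> _; apply: l1_norm; exact: l1_coef_diff.
rewrite -rsum_sum// -nsum_rsum; last exact: l1_sum.
  by apply: le_nsum => m; exact: hC.
by move=> m; exact: sumr_ge0.
Qed.

(** Specific to the sampling frequencies: n omega is a multiple of 2 pi, so e^{i(n+1+m) omega} =
    e^{i(1+m) omega}, and [pred_coef_rev] turns the tau > n part of [Jhat] into the second half of
    [Dmx]. *)
Lemma Jhat_omega n (x : 'cV[R]_n) (k : 'I_n) : (0 < n)%N ->
  Jhat c x (omega k) = \sum_(t < n) Dmx n c k t * (x t 0)%:C.
Proof.
move=> n0; have NR : n%:R != 0 :> R by rewrite pnatr_eq0 -lt0n.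
under eq_bigr do rewrite DmxE -mulrA.
rewrite -mulr_sumr /Jhat -mulrDr; congr (_ * _).
under [RHS]eq_bigr do rewrite mulrDl.
rewrite big_split; congr (_ + _).
  pose v (t : 'I_n) m := (pred_coef c (- m%:Z) t)%:C * cis (- (m%:R * omega k)).
  have lv (t : 'I_n) : true -> cl1 (fun m => (x t 0)%:C * v t m).
    by move=> _; apply: cl1Z; apply: cl1_cis; exact: l1_pred_coef oppz_inj.
  rewrite (_ : (fun m => _) = (fun m => \sum_(t < n) (x t 0)%:C * v t m)).
    rewrite cseriesE; last exact: cl1_sum.
    rewrite csum_sum//; apply: eq_bigr => t _.
    rewrite csumZ; last by apply: cl1_cis; exact: l1_pred_coef oppz_inj.
    by rewrite mulrC fourier_nonpos//; exact: l1_pred_coef oppz_inj.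
  apply/funext => m; rewrite /Xhat rmorph_sum/= mulr_suml.
  apply: eq_bigr => t _; rewrite /v mulrNz mulNr -pmulrn rmorphM/=; ring.
pose v (t : 'I_n) m := (pred_coef c (- m%:Z) (rev_ord t))%:C * cis (m%:R * omega k).
have lv0 (t : 'I_n) : cl1 (v t) by apply: cl1_cis; exact: l1_pred_coef oppz_inj.
have lv (t : 'I_n) : true -> cl1 (fun m => (cis (omega k) * (x t 0)%:C) * v t m).
  by move=> _; exact: cl1Z.
rewrite (_ : (fun m => _) =
    (fun m => \sum_(t < n) (cis (omega k) * (x t 0)%:C) * v t m)).
  rewrite cseriesE; last exact: cl1_sum.
  rewrite csum_sum//; apply: eq_bigr => t _.
  rewrite csumZ// conj_fourier_nonpos; last exact: l1_pred_coef oppz_inj.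
  by rewrite mulrAC.
apply/funext => m; rewrite /Xhat rmorph_sum/= mulr_suml.
have cE : cis ((n.+1 + m)%:R * (omega k : R)) = cis (omega k) * cis (m%:R * omega k).
  rewrite addSnnS natrD mulrDl (_ : n%:R * omega k = k.+1%:R * (2 * pi)).
    by rewrite cisD cis_2pi_nat mul1r -natr1 mulrDl mul1r addrC cisD.
  by rewrite /omega; field.
apply: eq_bigr => t _; rewrite cE /v -pred_coef_rev.
rewrite (_ : n.+1%:Z - - m%:Z = (n.+1 + m)%N%:Z); last by lia.
rewrite rmorphM/=; ring.
Qed.

Lemma Jhat_inf_omega n (x : 'cV[R]_n) (k : 'I_n) : (0 < n)%N ->
  Jhat_inf phi x (omega k) = \sum_(t < n) Dinf n phi k t * (x t 0)%:C.
Proof.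
move=> n0; have NR : n%:R != 0 :> R by rewrite pnatr_eq0 -lt0n.
under [RHS]eq_bigr do rewrite mxE mulrDl.
rewrite big_split /Jhat_inf; congr (_ + _).
  rewrite mulr_sumr; apply: eq_bigr => t _; ring.
have -> : cis (n.+1%:R * (omega k : R)) = cis (omega k).
  rewrite -natr1 mulrDl cisD (_ : n%:R * omega k = k.+1%:R * (2 * pi)).
    by rewrite cis_2pi_nat !mul1r.
  by rewrite /omega; field.
rewrite mulr_sumr [RHS](reindex_inj rev_ord_inj).
by apply: eq_bigr => t _; rewrite rev_ordK; ring.
Qed.

Lemma qform_FDD n (g : R -> R) (x : 'cV[R]_n) : (0 < n)%N ->
  qform (FDD n g c phi) x =
  \sum_(k < n) conjc (J x (omega k)) / (g (omega k))%:C *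
    (Jhat c x (omega k) - Jhat_inf phi x (omega k)).
Proof.
move=> n0; set DD := Dmx n c - Dinf n phi; set X := map_mx (real_complex R) x.
have -> : qform (FDD n g c phi) x =
    \sum_(k < n) (X^T *m adjoint (Fmx n)) 0 k * ((g (omega k))^-1)%:C * (DD *m X) k 0.
  rewrite /qform /FDD -/DD -/X -!mulmxA mulmxA mxE; apply: eq_bigr => k _.
  by rewrite -mulrA; congr (_ * _); rewrite /Delta mul_diag_mx mxE [X in X * _]mxE.
apply: eq_bigr => k _; congr (_ * _ * _).
- rewrite /J conjcM /isqrtn conjc_real rmorph_sum mulr_sumr mxE.
  apply: eq_bigr => s _; rewrite !mxE conjcM conjc_real mulrCA; congr (_ * _).
  by rewrite -[RHS]/(conjc (_ * _)) conjcM conjc_real.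
- by rewrite fmorphV.
- rewrite Jhat_omega// Jhat_inf_omega// -sumrB mxE; apply: eq_bigr => t _.
  by rewrite /DD /X !mxE mulrBl.
Qed.

End Matrices.

End Stability.

(** * Moments of quadratic forms *)

Section QuadraticFormMoments.
Context {R : realType}.
Local Notation normc := Normc.normc.

Lemma qformE n (A : 'M[R[i]]_n) (x : 'cV[R]_n) :
  qform A x = \sum_(s < n) \sum_(t < n) A s t * (x s 0 * x t 0)%:C.
Proof.
rewrite /qform -mulmxA mxE; apply: eq_bigr => s _.
rewrite !mxE mulr_sumr; apply: eq_bigr => t _.
by rewrite !mxE rmorphM/= mulrCA.
Qed.

(** The weight that x_s^2 receives when AM-GM is applied to every term of the quadratic form. Only
    squares of single variables remain, and the weights add up to [norm1]. *)
Definition sym_weight n (A : 'M[R[i]]_n) (s : 'I_n) : R :=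
  \sum_(t < n) (normc (A s t) + normc (A t s)) / 2.

Lemma sym_weight_ge0 n (A : 'M[R[i]]_n) s : 0 <= sym_weight A s.
Proof.
by apply: sumr_ge0 => t _; rewrite divr_ge0// addr_ge0 ?normc_ge0.
Qed.

Lemma sum_sym_weight n (A : 'M[R[i]]_n) : \sum_(s < n) sym_weight A s = norm1 A.
Proof.
rewrite /sym_weight /norm1.
under eq_bigr do under eq_bigr do rewrite mulrDl.
under eq_bigr do rewrite big_split/=.
rewrite big_split/= [X in _ + X]exchange_big/= -big_split/=.
apply: eq_bigr => s _; rewrite -big_split/=; apply: eq_bigr => t _.
by rewrite -splitr.
Qed.

(* AM-GM: [|x s * x t| <= (x s ^+ 2 + x t ^+ 2) / 2] *)
Lemma normc_qform_le n (A : 'M[R[i]]_n) (x : 'cV[R]_n) :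
  normc (qform A x) <= \sum_(s < n) sym_weight A s * x s 0 ^+ 2.
Proof.
rewrite qformE; apply: le_trans (normc_sum _ _ _) _.
apply: (@le_trans _ _ (\sum_(s < n) \sum_(t < n)
   normc (A s t) * ((x s 0 ^+ 2 + x t 0 ^+ 2) / 2))).
  apply: ler_sum => s _; apply: le_trans (normc_sum _ _ _) _.
  apply: ler_sum => t _; rewrite Normc.normcM normc_real ler_wpM2l ?normc_ge0//.
  rewrite ler_norml; have := sqr_ge0 (x s 0 - x t 0).
  have := sqr_ge0 (x s 0 + x t 0); rewrite sqrrD sqrrB => *; apply/andP; split; lra.
rewrite le_eqVlt; apply/orP; left; apply/eqP.
under eq_bigr do under eq_bigr do rewrite mulrDl mulrDr.
under eq_bigr do rewrite big_split/=.
rewrite big_split/= [X in _ + X]exchange_big/= -big_split/=.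
apply: eq_bigr => s _; rewrite -big_split/= mulr_suml; apply: eq_bigr => t _.
ring.
Qed.

Context {d : measure_display} {T : measurableType d} (P : probability T R).
Implicit Types (h k : T -> R) (q : R).

Lemma le_Lnorm q h k : 0 < q ->
  measurable_fun setT h -> measurable_fun setT k ->
  (forall w, 0 <= h w <= k w) ->
  (Lnorm P q%:E (EFin \o h) <= Lnorm P q%:E (EFin \o k))%E.
Proof.
move=> q0 mh mk hk; rewrite unlock.
have mp (l : T -> R) : measurable_fun setT l ->
    measurable_fun setT (EFin \o (fun w => `|l w| `^ q)).
  move=> ml; apply/measurable_EFinP.
  by apply: (measurableT_comp (measurable_powR q)); exact: measurableT_comp.
have q1 : 0 <= q^-1 by rewrite invr_ge0 ltW.
have I0 (l : T -> R) : (0 <= \int[P]_w (`|(EFin \o l) w| `^ q))%E.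
  by apply: integral_ge0 => w _; exact: poweR_ge0.
apply: (gt0_ler_poweR q1).
- by rewrite in_itv/= I0 leey.
- by rewrite in_itv/= I0 leey.
apply: ge0_le_integral => //.
- by move=> w _; exact: poweR_ge0.
- exact: mp.
- exact: mp.
- move=> w _; rewrite /= lee_fin ge0_ler_powR ?nnegrE ?(ltW q0)//.
  have /andP[h0 hkw] := hk w.
  by rewrite !ger0_norm// (le_trans h0).
Qed.

Lemma Lnorm_pZ q (r : R) h : 0 < q -> 0 <= r -> measurable_fun setT h ->
  Lnorm P q%:E (EFin \o (fun w => r * h w)) = (r%:E * Lnorm P q%:E (EFin \o h))%E.
Proof.
move=> q0 r0 mh; rewrite unlock.
rewrite (_ : (fun w => _) = (fun w => (r `^ q)%:E * (`|h w| `^ q)%:E)%E); last first.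
  by apply/funext => w; rewrite /= normrM ger0_norm// powRM// EFinM.
have mq : measurable_fun setT (EFin \o (fun w => `|h w| `^ q)).
  apply/measurable_EFinP; apply: (measurableT_comp (measurable_powR q)).
  exact: measurableT_comp.
rewrite ge0_integralZl_EFin//; last exact: powR_ge0.
rewrite poweRM ?lee_fin ?powR_ge0//; last first.
  by apply: integral_ge0 => w _; rewrite lee_fin powR_ge0.
rewrite poweR_EFin -powRrM divff ?gt_eqF// powRr1//.
Qed.

Lemma Lnorm_sqr q h : 0 < q -> (Lnorm P (2 * q)%:E (EFin \o h) < +oo)%E ->
  Lnorm P q%:E (EFin \o (fun w => h w ^+ 2)) = (Lnorm P (2 * q)%:E (EFin \o h) ^+ 2)%E.
Proof.
move=> q0; set L := Lnorm P (2 * q)%:E _ => Loo.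
have L0 : (0 <= L)%E by exact: Lnorm_ge0.
have Lf : L \is a fin_num by rewrite ge0_fin_numE.
rewrite -(fineK Lf) -EFin_expe -powR_mulrn ?fine_ge0// -poweR_EFin (fineK Lf).
rewrite /L unlock -poweRrM (_ : (2 * q)^-1 * 2 = q^-1); last first.
  by field; rewrite gt_eqF.
rewrite (eq_integral (fun w => `|(EFin \o h) w| `^ (2 * q))%E)// => w _.
by rewrite /= normrX -powR_mulrn// -powRrM.
Qed.

Lemma Lnorm_sum_le q (I : Type) (r : seq I) (y : I -> T -> R) : 1 <= q ->
  (forall s, measurable_fun setT (y s)) ->
  (Lnorm P q%:E (EFin \o (fun w => \sum_(s <- r) y s w)%R) <=
   \sum_(s <- r) Lnorm P q%:E (EFin \o y s))%E.
Proof.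
move=> q1 my; have qN0 : q%:E != 0%E by rewrite eqe gt_eqF// (lt_le_trans _ q1).
elim: r => [|s r ih].
  rewrite big_nil (_ : EFin \o _ = cst 0%E) ?Lnorm0//.
  by apply/funext => w /=; rewrite big_nil.
rewrite big_cons; apply: le_trans (leeD (lexx _) ih).
rewrite (_ : (fun w => _) = (y s \+ (fun w => \sum_(s <- r) y s w))%R).
  by apply: minkowski_EFin => //; exact: measurable_sum.
by apply/funext => w /=; rewrite big_cons.
Qed.

Variable X : int -> {RV P >-> R}.

Let mX (t : int) : measurable_fun setT (X t : T -> R).
Proof. exact: measurable_funP. Qed.

Lemma measurable_normc_qform n (A : 'M[R[i]]_n) :
  measurable_fun setT (fun w => normc (qform A (sample X n w))).
Proof.
pose B (l : 'M[R]_n) w := \sum_(s < n) \sum_(t < n) l s t * (X s.+1%:Z w * X t.+1%:Z w).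
have mB l : measurable_fun setT (B l).
  apply: measurable_sum => s; apply: measurable_sum => t.
  by apply: measurable_funM => //; exact: measurable_funM.
have ReD (z w : R[i]) : complex.Re (z + w) = complex.Re z + complex.Re w.
  by case: z w => ? ? [].
have ImD (z w : R[i]) : complex.Im (z + w) = complex.Im z + complex.Im w.
  by case: z w => ? ? [].
(* The modulus is rewritten through two real quadratic forms and a power 1/2, each visibly
   measurable. *)
have qE w : normc (qform A (sample X n w)) =
   (B (map_mx (@complex.Re R) A) w ^+ 2 + B (map_mx (@complex.Im R) A) w ^+ 2) `^ 2^-1.
  rewrite powR12_sqrt ?addr_ge0 ?sqr_ge0// qformE.
  set z := \sum_(s < n) _; rewrite [in LHS](_ : z = complex.Re z +i* complex.Im z); last by case: z.
  congr (Num.sqrt (_ ^+ 2 + _ ^+ 2)).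
    rewrite /z /B (big_morph _ ReD (erefl _)); apply: eq_bigr => s _.
    rewrite (big_morph _ ReD (erefl _)); apply: eq_bigr => t _.
    by rewrite !mxE; case: (A s t) => a b /=; rewrite mulr0 subr0.
  rewrite /z /B (big_morph _ ImD (erefl _)); apply: eq_bigr => s _.
  rewrite (big_morph _ ImD (erefl _)); apply: eq_bigr => t _.
  by rewrite !mxE; case: (A s t) => a b /=; rewrite mulr0 add0r.
rewrite (_ : (fun w => _) = fun w => (B (map_mx (@complex.Re R) A) w ^+ 2 +
   B (map_mx (@complex.Im R) A) w ^+ 2) `^ 2^-1); last exact/funext.
apply: (measurableT_comp (measurable_powR _)); apply: measurable_funD.
  by apply: measurable_funX.
by apply: measurable_funX.
Qed.

(** AM-GM bounds the modulus by a weighted sum of the X_s^2; Minkowski and ||X_s^2||_q =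
    ||X_s||_{2q}^2 then bound the norm by the total weight times the squared supremum. *)
Lemma Lnorm_qform_le q n (A : 'M[R[i]]_n) : 1 < q ->
  (sup_norm (2 * q) X < +oo)%E ->
  (Lnorm P q%:E (fun w => (normc (qform A (sample X n w)))%:E) <=
   (norm1 A)%:E * sup_norm (2 * q) X ^+ 2)%E.
Proof.
move=> q1 Soo; have q0 : 0 < q by exact: lt_trans q1.
pose y (s : 'I_n) w := sym_weight A s * X s.+1%:Z w ^+ 2.
have mX2 (t : int) : measurable_fun setT (fun w => X t w ^+ 2).
  by apply: measurable_funX.
have my s : measurable_fun setT (y s) by apply: measurable_funM.
apply: (@le_trans _ _ (Lnorm P q%:E (EFin \o (fun w => \sum_(s < n) y s w)%R))).
  apply: le_Lnorm => //; first exact: measurable_normc_qform.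
    exact: measurable_sum.
  move=> w; rewrite normc_ge0/=; apply: le_trans (normc_qform_le _ _) _.
  by rewrite le_eqVlt; apply/orP; left; apply/eqP/eq_bigr => s _; rewrite mxE.
apply: le_trans (Lnorm_sum_le _ (ltW q1) my) _.
rewrite -sum_sym_weight -sumEFin ge0_sume_distrl; last first.
  by move=> s _; rewrite lee_fin sym_weight_ge0.
apply: lee_sum => s _; rewrite Lnorm_pZ//; last exact: sym_weight_ge0.
have Xs : (Lnorm P (2 * q)%:E (EFin \o X s.+1%:Z) <= sup_norm (2 * q) X)%E.
  by apply: ereal_sup_ubound; exists s.+1%:Z.
rewrite lee_wpmul2l ?lee_fin ?sym_weight_ge0// Lnorm_sqr//; last first.
  exact: le_lt_trans Soo.
rewrite !expe2 lee_pmul//; exact: Lnorm_ge0.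
Qed.

End QuadraticFormMoments.

(** * The main bound *)

Section Factorisation.
Context {R : realType}.
Implicit Types (f g : R -> R) (c : int -> R) (phi psi : nat -> R).

Lemma normK0E (u : int -> R) : normK 0 u = (2%:E * abssum u)%E.
Proof.
rewrite /normK /abssum -nsum_pZ//; apply: eq_esum => r _.
by rewrite !powRr0.
Qed.

Lemma normK0_l1 (u : int -> R) : (normK 0 u < +oo)%E -> l1 u.
Proof.
rewrite normK0E => h; apply: le_lt_trans h.
by rewrite -[leLHS]mul1e lee_wpmul2r ?abssum_ge0// lee_fin ler1n.
Qed.

Lemma normK0_nrm (u : int -> R) : l1 u -> normK 0 u = (2 * nrm u)%:E.
Proof. by move=> lu; rewrite normK0E abssum_rsum. Qed.

Lemma ar_coef_supp_le phi : supp_le 0 (ar_coef phi).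
Proof. by case=> [[|m]|m]. Qed.

Lemma ma_coef_supp_le psi : supp_le 0 (ma_coef psi).
Proof. by case=> [[|m]|m]. Qed.

Lemma nrm_ge1 (u : int -> R) : l1 u -> u 0 = 1 -> 1 <= nrm u.
Proof. by move=> lu u0; rewrite -[1]normr1 -u0; exact: ler_nrm_term. Qed.

Lemma l1_moment (K : R) c : 1 < K ->
  (\esum_(r in [set: int]) (`| `|r%:~R| `^ K * c r|)%:E < +oo)%E -> l1 c.
Proof.
move=> K1 hK; have lK : l1 (fun r : int => `|r%:~R| `^ K * c r) by [].
(* The weight |r|^K is at least 1 off the origin but vanishes at r = 0, so the term c 0 is supplied
   separately. *)
have ld := l1Z (c 0) (@l1_deltaz R 0).
apply: l1_le (l1D (l1_norm lK) (l1_norm ld)) => r.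
rewrite [leRHS]ger0_norm ?addr_ge0// /delta.
have [->|r0] := eqVneq r 0; first by rewrite mulr1 lerDr.
rewrite mulr0 normr0 addr0 normrM ler_peMl// ger0_norm ?powR_ge0//.
have r1 : 1 <= `|r%:~R| :> R by rewrite norm_intr_ge1 ?intr_int// intr_eq0.
rewrite -[leLHS](powRr0 `|r%:~R|); apply: ler_powR => //.
by apply/ltW/lt_trans/K1.
Qed.

Section Coefficients.
Variables (f : R -> R) (c : int -> R) (sigma : R) (phi psi : nat -> R).
Hypothesis hf : spectral_density f c.
Hypothesis hphi : canonical_factorisation f sigma phi psi.
Let a := ar_coef phi.
Let p := ma_coef psi.

Lemma l1_ar : l1 a. Proof. exact/normK0_l1/(cf_phi_summable hphi). Qed.
Lemma l1_ma : l1 p. Proof. exact/normK0_l1/(cf_psi_summable hphi). Qed.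

Lemma ar_fun_neq0 w : 0 <= w <= 2 * pi -> ar_fun phi w != 0.
Proof.
move=> hw; apply/eqP => a0; have := sd_gt0 hf hw.
rewrite (cf_ma hphi hw) (cf_inverse hphi) a0 invr0 Normc.normc0 expr0n mulr0.
by rewrite ltxx.
Qed.

Lemma ar_ma_inverse : zconv a p =1 delta 0.
Proof.
have la := l1_ar; have lp := l1_ma.
apply: fourier_inj => [||w hw]; [exact: l1_conv|exact: l1_deltaz|].
rewrite fourier_conv// fourier_delta mul0r cis0.
rewrite -[fourier p w]/(ma_fun psi w) (cf_inverse hphi) mulfV//.
exact: ar_fun_neq0.
Qed.

Lemma autocov_ma : l1 c -> c =1 (fun r => sigma ^+ 2 * zconv p (refl p) r).
Proof.
move=> lc; have lp := l1_ma; have lp' := l1_refl lp; have lpp := l1_conv lp lp'.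
apply: fourier_inj => // [|w hw]; first exact: l1Z.
rewrite fourierZ// fourier_conv// fourier_refl// normc_sqr_conj.
rewrite -rmorphM -(sd_fourier hf hw); congr (_%:C).
  exact: (cf_ma hphi hw).
Qed.

(** Fourier coefficients of 1/f = sigma^-2 |phi_f|^2. Applied to f_theta, this is the origin of the
    factors sigma_g^-2 and ||phi_g||_0^2 in [A_const]. *)
Definition inv_coef (r : int) : R := sigma ^- 2 * zconv a (refl a) r.

Lemma l1_inv_coef : l1 inv_coef.
Proof. by apply: l1Z; apply: l1_conv; [|apply: l1_refl]; exact: l1_ar. Qed.

Lemma fourier_inv_coef w : 0 <= w <= 2 * pi ->
  ((f w)^-1)%:C = fourier inv_coef w.
Proof.
move=> hw; have la := l1_ar; have la' := l1_refl la.
rewrite fourierZ; last exact: l1_conv.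
rewrite fourier_conv// fourier_refl// normc_sqr_conj -rmorphM.
by rewrite (cf_ar hphi hw) invfM invrK.
Qed.

Lemma nrm_inv_coef : nrm inv_coef <= sigma ^- 2 * nrm a ^+ 2.
Proof.
have la := l1_ar; have la' := l1_refl la; have laa := l1_conv la la'.
have s0 : 0 <= sigma ^- 2 by rewrite invr_ge0 sqr_ge0.
rewrite nrmZ// ger0_norm// ler_wpM2l// expr2 -{2}(nrm_refl a).
exact: nrm_conv.
Qed.

End Coefficients.

(** With u = n + 1 + k, both k + 1 <= u and n^{K-1} <= u^{K-1} hold; multiply them. *)
Lemma tail_moment_le_rho (n : nat) (K : R) phi : (0 < n)%N -> 1 < K ->
  (nsum (fun k => k.+1%:R * `|ar_coef phi (- (n.+1 + k)%N%:Z)|)%R <=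
   ((n%:R `^ (K - 1))^-1)%:E * rho n K phi)%E.
Proof.
move=> n0 K1.
have -> : rho n K phi = nsum (fun k => `|(n.+1 + k)%:R `^ K * phi (n.+1 + k)%N|).
  rewrite /rho -nneseries_addn => [|i]; last by rewrite lee_fin.
  rewrite nneseries_esumT => [|i]; last by rewrite lee_fin.
  by apply: eq_esum => k _; rewrite addnC.
have nK : 0 < n%:R `^ (K - 1) :> R by rewrite powR_gt0// ltr0n.
rewrite -nsum_pZ ?invr_ge0 ?(ltW nK)//; apply: le_nsum => k.
rewrite (_ : ar_coef _ _ = - phi (n.+1 + k)%N) // normrN normrM mulrA.
rewrite ler_wpM2r// ger0_norm ?powR_ge0// mulrC ler_pdivlMr//.
set u := (n.+1 + k)%N.
have u0 : 0 < u%:R :> R by rewrite ltr0n.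
have -> : u%:R `^ K = u%:R * u%:R `^ (K - 1) :> R.
  rewrite -[X in X * _]powRr1 ?(ltW u0)// -powRD ?subrKC//.
  by rewrite (gt_eqF u0) implybT.
apply: ler_pM; rewrite ?(ltW nK)//.
  by rewrite ler_nat /u; lia.
by rewrite ge0_ler_powR ?nnegrE ?ler0n ?subr_ge0 ?(ltW K1)// ler_nat /u; lia.
Qed.

Lemma normK_ge1 (K : R) (u : int -> R) : 0 <= K -> u 0 = 1 -> (1 <= normK K u)%E.
Proof.
move=> K0 u0; pose v (r : int) := (2 `^ K + `|r%:~R| `^ K) * `|u r|.
have v0 r : 0 <= v r by rewrite mulr_ge0 ?addr_ge0 ?powR_ge0.
apply: (@le_trans _ _ (nsum (fun r => if r == 0 then v 0 else 0))); last first.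
  by apply: le_nsum => r; case: eqP => [->|_].
rewrite (nsum_delta (a := 0)) ?eqxx// => [|r /negbTE ->//].
rewrite lee_fin /v u0 normr1 mulr1 (@le_trans _ _ (2 `^ K))//.
  by rewrite -[leLHS](powRr0 2) ler_powR// ler1n.
by rewrite lerDl powR_ge0.
Qed.

(** Used with k = ||phi_f||_K, an extended real that enters the comparison through the bound k >=
    1. *)
Lemma mule_ge1 (x y : R) (k : \bar R) : 0 <= y -> x <= y -> (1 <= k)%E ->
  (x%:E <= y%:E * k)%E.
Proof.
move=> y0 xy k1; apply: (@le_trans _ _ y%:E); first by rewrite lee_fin.
by rewrite -[leLHS]mule1 lee_wpmul2l ?lee_fin.
Qed.

Lemma mule_regroup (x y z t : \bar R) : (x * y * z * t = x * t * (z * y))%E.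
Proof. by rewrite -!muleA; congr (_ * _)%E; rewrite [RHS]muleC -[RHS]muleA [LHS]muleCA. Qed.

Lemma mule_pull (k x y z t : \bar R) :
  (k * (x * y * z * t) = x * y * (k * z) * t)%E.
Proof. by rewrite muleA; congr (_ * _)%E; rewrite muleCA. Qed.

End Factorisation.

Theorem theorem3p1 (R : realType) (K : R)
    (f : R -> R) (c : int -> R) (sigma : R) (phi psi : nat -> R)
    (hK : 1 < K)
    (hf : spectral_density f c)
    (hf0 : bounded_away_from_zero f)
    (hfK : (\esum_(r in [set: int]) (`| `|r%:~R| `^ K * c r|)%:E < +oo)%E)
    (hphi : canonical_factorisation f sigma phi psi) :
  exists eps : R, 0 < eps < 1 /\
  forall (g : R -> R) (cg : int -> R) (sigmag : R) (phig psig : nat -> R),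
    spectral_density g cg ->
    bounded_away_from_zero g ->
    (normK 0 cg < +oo)%E ->
    canonical_factorisation g sigmag phig psig ->
  forall n : nat, (0 < n)%N ->
  [/\ forall x : 'cV[R]_n,
        qform (FDD n g c phi) x =
        \sum_(k < n) conjc (J x (omega k)) / (g (omega k))%:C *
          (Jhat c x (omega k) - Jhat_inf phi x (omega k)),
      ((norm1 (FDD n g c phi))%:E <=
        C_const eps 0 phi psi * rho n K phi * ((n%:R `^ (K - 1))^-1)%:E
        * A_const K phi psi sigmag phig)%E &
      forall (d : measure_display) (T : measurableType d)
          (P : probability T R) (X : int -> {RV P >-> R}) (q : R),
        1 < q ->
        (sup_norm (2 * q) X < +oo)%E ->
        ((n%:R^-1)%:E *
          Lnorm P q%:E
            (fun w => (Normc.normc (qform (FDD n g c phi) (sample X n w)))%:E)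
         <= C_const eps 0 phi psi * rho n K phi * ((n%:R `^ K)^-1)%:E
            * A_const K phi psi sigmag phig * sup_norm (2 * q) X ^+ 2)%E ].
Proof.
have la := l1_ar hphi; have lp := l1_ma hphi.
have lc : l1 c by exact: (l1_moment hK hfK).
have s2 : 0 < sigma ^+ 2 by rewrite exprn_gt0 ?(cf_sigma_gt0 hphi).
have a0 := @ar_coef_supp_le R phi; have p0 := @ma_coef_supp_le R psi.
have ap := ar_ma_inverse hf hphi; have cpp := autocov_ma hf hphi lc.
have ce := sd_even hf.
have aE j : ar_coef phi (- j.+1%:Z) = - phi j.+1 by [].
have [C C0 hC] := norm1_FDD_bound la lp lc s2 a0 p0 ap cpp ce aE (cf_inverse hphi).
have na : 1 <= nrm (ar_coef phi) by exact: nrm_ge1.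
have np : 1 <= nrm (ma_coef psi) by exact: nrm_ge1.
(* Here 1 - eps = 1 / (C + 2), so D = 2 (C + 2) + 1 >= C, and C + 2 > 1 puts eps strictly between 0
   and 1. *)
pose eps := 1 - (C + 2)^-1; pose D := (3 - eps) / (1 - eps).
exists eps; split.
  rewrite /eps subr_gt0 ltrBlDr ltrDl invr_gt0 invf_lt1; lra.
move=> g cg sigmag phig psig hg _ _ hphig n n0.
have lag := l1_ar hphig; have nag := nrm_ge0 lag.
have hS := hC n g _ n0 (l1_inv_coef hphig) (fourier_inv_coef hphig).
have eC : C <= D.
  rewrite /D /eps (_ : 1 - (1 - (C + 2)^-1) = (C + 2)^-1); last by lra.
  rewrite invrK; have : (C + 2)^-1 * (C + 2) = 1 by rewrite mulVf//; lra.
  lra.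
have bound : ((norm1 (FDD n g c phi))%:E <=
    C_const eps 0 phi psi * rho n K phi * ((n%:R `^ (K - 1))^-1)%:E
    * A_const K phi psi sigmag phig)%E.
  apply: le_trans hS _.
  have rho0 : (0 <= rho n K phi)%E by apply: nneseries_ge0 => k _ _; rewrite lee_fin.
  have X0 : 0 <= (n%:R `^ (K - 1))^-1 :> R by rewrite invr_ge0 powR_ge0.
  have sg0 : 0 <= sigmag ^- 2 by rewrite invr_ge0 sqr_ge0.
  rewrite mule_regroup.
  apply: (@le_trans _ _ ((C * nrm (inv_coef sigmag phig))%:E *
     (((n%:R `^ (K - 1))^-1)%:E * rho n K phi))%E).
    apply: lee_wpmul2l; last exact: tail_moment_le_rho.
    by rewrite lee_fin mulr_ge0 ?nrm_ge0//; exact: (l1_inv_coef hphig).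
  apply: lee_wpmul2r; first by rewrite mule_ge0 ?lee_fin.
  rewrite /C_const /A_const !normK0_nrm// -!EFin_expe -!EFinM muleA -EFinM.
  rewrite -/D; have D0 : 0 <= D by exact: (le_trans C0 eC).
  clearbody D.
  apply: mule_ge1.
  - by rewrite !mulr_ge0 ?sqr_ge0 ?nrm_ge0.
  - have h := nrm_inv_coef hphig.
    set A := nrm (ar_coef phi) in na *; set B := nrm (ma_coef psi) in np *.
    set G := nrm (ar_coef phig) in nag h *; set N := nrm _ in h *.
    have q1 : C * N <= D * (sigmag ^- 2 * G ^+ 2).
      apply: ler_pM => //; exact: (nrm_ge0 (l1_inv_coef hphig)).
    apply: le_trans q1 _.
    (* Each norm of index 0 is twice [nrm]: [C_const] contributes 2^4 A^2 B^2 and [A_const]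
       contributes 2^4 B G^2. The surplus 256 A^2 B^3 is at least 1 because phi_f and psi_f have
       constant term 1. *)
    rewrite (_ : _ * _ * (2 * B) ^+ 2 * _ =
      D * (sigmag ^- 2 * G ^+ 2) * (256 * (A ^+ 2 * B ^+ 3))); last by ring.
    rewrite ler_peMr ?mulr_ge0// ?sqr_ge0//.
    have := mulr_ege1 (exprn_ege1 2 na) (exprn_ege1 3 np); lra.
  - by apply: normK_ge1 => //; lra.
split => //.
- move=> x.
  exact: (qform_FDD la lp lc s2 ap cpp ce).
- move=> d T P X q q1 Soo.
  have nR : 0 < n%:R :> R by rewrite ltr0n.
  apply: (@le_trans _ _ ((n%:R^-1)%:E *
    ((norm1 (FDD n g c phi))%:E * sup_norm (2 * q) X ^+ 2))%E).
    by rewrite lee_wpmul2l ?lee_fin ?invr_ge0 ?(ltW nR)// Lnorm_qform_le.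
  rewrite muleA; apply: lee_wpmul2r; first exact: sqre_ge0.
  rewrite (_ : (n%:R `^ K)^-1 = n%:R^-1 * (n%:R `^ (K - 1))^-1); last first.
    rewrite -invfM -[X in X * _]powRr1 ?(ltW nR)// -powRD ?subrKC//.
    by rewrite (gt_eqF nR) implybT.
  apply: le_trans (lee_wpmul2l _ bound) _; first by rewrite lee_fin invr_ge0 ltW.
  by rewrite EFinM mule_pull.
Qed.
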